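(* Let $b$ be a locally finite graph over $(X,m)$, $q:X\to\mathbb{R}$, and let the associated form $h$ be bounded from below on $\ell^2(X,m)$. Let $K\subseteq X$ be a finite set and let $w_N:X\to[0,\infty)$, $N\in\mathbb{N}$, be such that $h\ge w_N$ on $C_c(X\setminus K)$ for all $N$. Suppose there is a constant $0<\gamma<1$ and a (pointwise) monotone increasing sequence $(g_N)$ of nonnegative functions in $C(X)$ converging pointwise to some $g:X\to[0,\infty)$ such that for all large $N$ $$\big|\nabla g_N^{1/2}\big|^2\le\gamma\,g_N\,w_N\qquad\text{on }X.$$ Let $w=\liminf_{N\to\infty}w_N:X\to[0,\infty)$. Let $f\in C_c(X)$ and let $u$ be either (a) an approximable function $u\in\mathcal{F}$ that is a solution of $\mathcal{H}u=f$ or a positive subsolution (i.e. $u\ge0$ and $\mathcal{H}u\le f$), or (b) a solution $u\in D(H)$ of $\mathcal{H}u=f$, where in this case $q\in V$ is assumed. Then $u\in\ell^2(X,gwm)$. Moreover, whenever $w_N\ge w$ for all $N$, the same conclusion holds also for $f\in\ell^2(X,gw^{-1}m)$ whose support is included in the support of $w$.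
   Context: $X$ is an infinite countable set, $m:X\to(0,\infty)$, and a graph $b$ over $(X,m)$ is a symmetric function $b:X\times X\to[0,\infty)$ with zero diagonal and $\sum_{y}b(x,y)<\infty$ for all $x$; it is locally finite if $\#\{y:b(x,y)>0\}<\infty$ for all $x$. $C(X)$ is the space of real functions on $X$, $C_c(X)$ those with finite support, and for $W\subseteq X$, $C_c(W)$ consists of those $\varphi\in C_c(X)$ vanishing outside $W$. For $f\in C(X)$, $|\nabla f|^2(x)=\frac{1}{2m(x)}\sum_{y}b(x,y)(f(x)-f(y))^2$. For $q:X\to\mathbb{R}$, $h(\varphi)=h_{b,q}(\varphi)=\sum_{X}(|\nabla\varphi|^2+q\varphi^2)m$ for $\varphi\in C_c(X)$. ''$h\ge w$ on $C_c(W)$'' means $h(\varphi)\ge\sum_X w\varphi^2m$ for all $\varphi\in C_c(W)$. $h$ bounded from below on $\ell^2(X,m)$ means $h(\varphi)\ge -C\sum_X\varphi^2m$ on $C_c(X)$ for some $C$; then $h$ is closable, its closure is again denoted $h$ with domain $D(h)$, and $H$ is the associated self-adjoint operator with domain $D(H)$. $H$ is a restriction of the formal operator $\mathcal{H}f(x)=\frac1{m(x)}\sum_y b(x,y)(f(x)-f(y))+q(x)f(x)$, defined on $\mathcal{F}=\{f\in C(X):\sum_y b(x,y)|f(y)|<\infty\ \forall x\in X\}$. $V$ is the set of $q\in C(X)$, $q=q_+-q_-$ (positive and negative parts), such that for some $\varepsilon>0,C>0$: $\sum_X q_-\varphi^2m\le(1-\varepsilon)h_{b,q_+}(\varphi)+C\sum_X\varphi^2m$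 for all $\varphi\in C_c(X)$. A function $u\in\mathcal{F}$ is approximable if there is a sequence $(\varphi_n)$ in $C_c(X)$ with $0\le\varphi_n\nearrow1$ pointwise and $\lim_{n\to\infty}\sum_Xu^2|\nabla\varphi_n|^2m=0$. For a weight $\mu\ge0$, $u\in\ell^2(X,\mu)$ means $\sum_Xu^2\mu<\infty$; for $f$ supported in $\operatorname{supp}w=\{w>0\}$, $f\in\ell^2(X,gw^{-1}m)$ means $\sum_{\{w>0\}}f^2gw^{-1}m<\infty$. *)

(* Defs.v *)
From HB Require Import structures.
From mathcomp Require Export all_boot all_order all_algebra.
From mathcomp Require Export all_classical all_reals all_analysis.
Export Order.TTheory GRing.Theory Num.Theory.
Export numFieldNormedType.Exports.

Set Implicit Arguments.
Unset Strict Implicit.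
Unset Printing Implicit Defensive.

Local Open Scope classical_set_scope.
Local Open Scope ring_scope.

Section GraphForms.
Context {R : realType} {X : countType}.
Implicit Types (b : X -> X -> R) (m q w mu f u v phi : X -> R) (W : set X).

(* Sum of a real family over X; meaningful for absolutely summable families,
   which is the only way it is used below (`\esum` alone is only a sum for
   nonnegative families). *)
Definition sumX f : R :=
  fine (\esum_(x in [set: X]) (f^\+ x)%:E)
  - fine (\esum_(x in [set: X]) (f^\- x)%:E).

Record is_graph b : Prop := IsGraph {
  graph_sym : forall x y, b x y = b y x;
  graph_ge0 : forall x y, 0 <= b x y;
  graph_diag : forall x, b x x = 0;
  graph_sum : forall x, (\esum_(y in [set: X]) (b x y)%:E < +oo)%E }.

Definition locally_finite b : Prop := forall x, finite_set [set y | 0 < b x y].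

Definition supp f : set X := [set x | f x != 0].

Definition Cc W : set (X -> R) :=
  [set phi | finite_set (supp phi) /\ supp phi `<=` W].

(* f \in l^2(W, mu), for a weight mu that is nonnegative on W *)
Definition l2 W mu f : Prop := (\esum_(x in W) (f x ^+ 2 * mu x)%:E < +oo)%E.

Definition inner m u v : R := sumX (fun x => u x * v x * m x).

Definition gradsq b m f (x : X) : \bar R :=
  (((2 * m x)^-1)%:E * \esum_(y in [set: X]) (b x y * (f x - f y) ^+ 2)%:E)%E.

(* Only evaluated at finitely supported phi, where gradsq is finite. *)
Definition hform b m q phi : R :=
  sumX (fun x => (fine (gradsq b m phi x) + q x * phi x ^+ 2) * m x).

Definition hform_ge b m q w W : Prop :=
  forall phi, Cc W phi -> sumX (fun x => w x * phi x ^+ 2 * m x) <= hform b m q phi.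

Definition bounded_below b m q : Prop :=
  exists C : R, hform_ge b m q (fun=> - C) [set: X].

(* Kato's h-convergence: phi_n -> u in l^2(X, m) and h(phi_n - phi_k) -> 0. *)
Definition hconv b m q (phin : nat -> X -> R) u : Prop :=
  [/\ forall n, Cc [set: X] (phin n),
      (\esum_(x in [set: X]) ((phin n x - u x) ^+ 2 * m x)%:E)%E @[n --> \oo] --> 0%E
    & forall e : R, 0 < e -> exists N : nat, forall n k : nat,
        (N <= n)%N -> (N <= k)%N -> `|hform b m q (phin n \- phin k)| < e].

Definition domh b m q : set (X -> R) :=
  [set u | l2 [set: X] m u /\ exists phin, hconv b m q phin u].

(* The closure of h on domh: h(u) = lim h(phi_n) for h-convergent phi_n -> u.
   The limit does not depend on phi because h is closable as soon as it is
   bounded from below. *)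
Definition hclosure b m q u : R :=
  xget 0 [set r | exists2 phin, hconv b m q phin u &
                    hform b m q (phin n) @[n --> \oo] --> r].

Definition hclosure2 b m q u v : R :=
  (hclosure b m q (u \+ v) - hclosure b m q (u \- v)) / 4.

(* u \in D(H) and H u = v, where H is the self-adjoint operator associated with
   the closed form h by the first representation theorem. *)
Definition Hop b m q u v : Prop :=
  [/\ domh b m q u, l2 [set: X] m v &
      forall phi, domh b m q phi -> hclosure2 b m q u phi = inner m v phi].

Definition domH b m q : set (X -> R) := [set u | exists v, Hop b m q u v].

Definition domFormal b : set (X -> R) :=
  [set f | forall x, (\esum_(y in [set: X]) (b x y * `|f y|)%:E < +oo)%E].

Definition Hformal b m q f (x : X) : R :=
  (m x)^-1 * sumX (fun y => b x y * (f x - f y)) + q x * f x.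

Definition solution b m q f u : Prop :=
  domFormal b u /\ forall x, Hformal b m q u x = f x.

Definition positive_subsolution b m q f u : Prop :=
  [/\ domFormal b u, forall x, 0 <= u x & forall x, Hformal b m q u x <= f x].

Definition classV b m q : Prop :=
  exists eps C : R, [/\ 0 < eps, 0 < C &
    forall phi, Cc [set: X] phi ->
      sumX (fun x => q^\- x * phi x ^+ 2 * m x) <=
      (1 - eps) * hform b m q^\+ phi + C * sumX (fun x => phi x ^+ 2 * m x)].

Definition approximable b m u : Prop :=
  domFormal b u /\
  exists phin : nat -> X -> R,
    [/\ forall n, Cc [set: X] (phin n),
        forall n x, 0 <= phin n x,
        forall x, {homo phin ^~ x : n k / (n <= k)%N >-> n <= k},
        forall x, phin n x @[n --> \oo] --> (1 : R)
      & (\esum_(x in [set: X]) ((u x ^+ 2)%:E * gradsq b m (phin n) x * (m x)%:E))%E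
          @[n --> \oo] --> 0%E].

Definition admissible b m q f u : Prop :=
  (approximable b m u /\ (solution b m q f u \/ positive_subsolution b m q f u))
  \/ [/\ classV b m q, domH b m q u & solution b m q f u].

End GraphForms.

(* Main.v *)
Require Import Defs.
From mathcomp Require Import ring lra.

(* Agmon-type argument.  With G = min(sqrt(g_N), N) outside K and G = 0 on K,
   insert v G into h >= w_N, where v is a finitely supported approximation of u.
   The product identity
     h(v G) = h(v, v G^2) + 1/2 sum_(x,y) b(x,y) v(x) v(y) (G(x) - G(y))^2
   bounds the left side by the source term plus sum v^2 |grad G|^2 m.  Truncating
   sqrt(g_N) at N keeps |grad G|^2 <= gamma G^2 w_N, and the cutoff at K only costs
   a finitely supported term bounded in N, so the gradient term is absorbed because
   gamma < 1; the source term is finitely supported or absorbed by Young's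
   inequality.  Letting first v -> u and then N -> oo on finite sets gives the bound.
   In the approximable case v = u phi_n, and the truncation makes the error caused
   by |grad phi_n| vanish for fixed N.  In the domain case v = v_n converges to u in
   the form norm; q in V and the bound on |grad G|^2 keep v_n G^2 bounded in that
   norm, hence h(v_n, v_n G^2) can be replaced by sum f v_n G^2 m in the limit.
   By local finiteness all these are sums over one finite sequence containing the
   supports and their neighbours. *)

Set Implicit Arguments.
Unset Strict Implicit.
Unset Printing Implicit Defensive.

Local Open Scope classical_set_scope.
Local Open Scope ring_scope.

(** * Finite sums and finite energies *)

Section FiniteSums.
Context {R : realType} {X : countType}.
Implicit Types (f F : X -> R) (s t : seq X) (A : set X).

(** Once zero terms are dropped the two sequences are permutations of each other, so a sum may be
    moved to any sequence that sees the same nonzero terms. *)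
Lemma sum_seq_widen s t f : uniq s -> uniq t ->
  (forall x, x \in s -> f x != 0 -> x \in t) ->
  (forall x, x \in t -> f x != 0 -> x \in s) ->
  \sum_(x <- s) f x = \sum_(x <- t) f x.
Proof.
move=> us ut st ts.
rewrite (bigID (fun x => f x == 0)) [RHS](bigID (fun x => f x == 0)) /=.
rewrite big1 => [|x /eqP//]; rewrite [in RHS]big1 => [|x /eqP//].
rewrite !add0r -big_filter -[RHS]big_filter; apply: perm_big.
apply: uniq_perm; rewrite ?filter_uniq// => x; rewrite !mem_filter.
by case: eqVneq => //= fx; apply/idP/idP => [/st|/ts]; apply.
Qed.

Lemma ler_sum_subseq s t f : uniq s -> uniq t -> (forall x, 0 <= f x) ->
  (forall x, x \in s -> f x != 0 -> x \in t) ->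
  \sum_(x <- s) f x <= \sum_(x <- t) f x.
Proof.
move=> us ut f0 st.
rewrite (_ : \sum_(x <- s) f x = \sum_(x <- t | x \in s) f x).
  by rewrite [leRHS](bigID (mem s))/= lerDl sumr_ge0.
rewrite -[in RHS]big_filter (_ : \sum_(x <- _) f x =
  \sum_(x <- [seq x <- t | x \in s]) f x)//.
apply: sum_seq_widen => // [|x xs fx|x]; rewrite ?filter_uniq// mem_filter.
  by rewrite xs st.
by case/andP.
Qed.

Lemma esum_ge_seq A (a : X -> \bar R) s : uniq s ->
  (forall x, x \in s -> A x) -> (\sum_(x <- s) a x <= \esum_(x in A) a x)%E.
Proof.
move=> us sA; rewrite fsbig_seq//; apply: esum_ge.
exists [set` s] => //; split; [exact: finite_seq|exact: sA].
Qed.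

Lemma esum_le_seq A (a : X -> \bar R) (B : \bar R) :
  (forall s, uniq s -> (forall x, x \in s -> A x) -> (\sum_(x <- s) a x <= B)%E) ->
  (\esum_(x in A) a x <= B)%E.
Proof.
move=> H; apply: ub_ereal_sup => _ [D [/finite_seqP[s ->]] sA <-].
have -> : [set` s] = [set` undup s].
  by apply/seteqP; split => x /=; rewrite mem_undup.
rewrite -fsbig_seq ?undup_uniq//; apply: H; first exact: undup_uniq.
by move=> x; rewrite mem_undup => xs; apply: sA.
Qed.

Lemma esum_seq s f : uniq s -> (forall x, 0 <= f x) ->
  (forall x, x \notin s -> f x = 0) ->
  \esum_(x in [set: X]) (f x)%:E = (\sum_(x <- s) f x)%:E.
Proof.
move=> us f0 fs; apply/le_anti/andP; split; last first.
  by rewrite -sumEFin; exact: esum_ge_seq.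
apply: esum_le_seq => t ut _; rewrite sumEFin lee_fin.
apply: ler_sum_subseq => // x _ fx; apply: contraT => /fs fx0.
by rewrite fx0 eqxx in fx.
Qed.

Lemma sumX_seq s f : uniq s -> (forall x, x \notin s -> f x = 0) ->
  sumX f = \sum_(x <- s) f x.
Proof.
move=> us fs; rewrite /sumX !(@esum_seq s)//; last first.
- by move=> x /fs fx; rewrite /funrpos fx maxxx.
- by move=> x /fs fx; rewrite /funrneg fx oppr0 maxxx.
rewrite /= -sumrB; apply: eq_bigr => x _.
rewrite /funrpos /funrneg; case: (leP (f x) 0) => fx; case: (leP (- f x) 0) => fx'; lra.
Qed.

Lemma finite_set_uniq A : finite_set A ->
  exists2 s, uniq s & forall x, (x \in s) <-> A x.
Proof.
move=> /finite_seqP[s ->]; exists (undup s); first exact: undup_uniq.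
by move=> x /=; rewrite mem_undup.
Qed.

Lemma cvg_sum_seq s (F : nat -> X -> R) f :
  (forall x, x \in s -> F n x @[n --> \oo] --> f x) ->
  \sum_(x <- s) F n x @[n --> \oo] --> \sum_(x <- s) f x.
Proof.
elim: s => [|x s IH] H.
  rewrite big_nil; under eq_fun do rewrite big_nil; exact: cvg_cst.
rewrite big_cons; under eq_fun do rewrite big_cons.
apply: cvgD; first by apply: H; rewrite mem_head.
by apply: IH => y ys; apply: H; rewrite inE ys orbT.
Qed.

End FiniteSums.

(** * Bilinear energies over a finite sequence of vertices *)

Section FiniteEnergy.
Context {R : realType} {X : countType}.
Variables (b : X -> X -> R) (p : X -> R).
Implicit Types (f g v psi : X -> R) (s t : seq X) (A : set X).

(* [p] stands for [q m]; for [f = g] this is [h f] once [s] contains the support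
   of [f] and its neighbours. *)
Definition energy s f g : R :=
  (\sum_(x <- s) \sum_(y <- s) b x y * ((f x - f y) * (g x - g y))) / 2
  + \sum_(x <- s) p x * (f x * g x).

(** The measure is cleared: when [s] contains all neighbours of [x], this is |grad f|^2(x) m(x). *)
Definition grad_on s f (x : X) : R := (\sum_(y <- s) b x y * (f x - f y) ^+ 2) / 2.

Definition lapl_on s f (x : X) : R :=
  \sum_(y <- s) b x y * (f x - f y) + p x * f x.

(** Meant for [A] the support of an argument of the energy: no nonzero edge term meeting [A] is then
    lost by summing over [s] only. *)
Definition nbhd_seq A s : Prop :=
  uniq s /\ forall x, A x -> x \in s /\ forall y, b x y != 0 -> y \in s.

Lemma nbhd_seq_sub A B s : A `<=` B -> nbhd_seq B s -> nbhd_seq A s.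
Proof. by move=> AB [us H]; split=> // x /AB/H. Qed.

Lemma energyDl s f f' g : energy s (f \+ f') g = energy s f g + energy s f' g.
Proof.
rewrite /energy /= addrACA -mulrDl -!big_split/=; congr (_ / _ + _).
  apply: eq_bigr => x _; rewrite -big_split/=; apply: eq_bigr => y _; ring.
by apply: eq_bigr => x _; ring.
Qed.

Lemma energyZl s c f g : energy s (fun x => c * f x) g = c * energy s f g.
Proof.
rewrite /energy mulrDr mulrA !mulr_sumr; congr (_ / _ + _).
  apply: eq_bigr => x _; rewrite mulr_sumr; apply: eq_bigr => y _; ring.
by apply: eq_bigr => x _; ring.
Qed.

Lemma energyC s f g : energy s f g = energy s g f.
Proof.
rewrite /energy; congr (_ / _ + _).
  by apply: eq_bigr => x _; apply: eq_bigr => y _; rewrite [X in _ * X]mulrC.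
by apply: eq_bigr => x _; rewrite [X in _ * X]mulrC.
Qed.

Lemma sum2_sym s (F : X -> X -> R) :
  \sum_(x <- s) \sum_(y <- s) F x y = \sum_(x <- s) \sum_(y <- s) F y x.
Proof. exact: exchange_big. Qed.

Lemma energy_diag s f :
  energy s f f = \sum_(x <- s) (grad_on s f x + p x * f x ^+ 2).
Proof. by rewrite big_split/= /energy mulr_suml. Qed.

Hypothesis bsym : forall x y, b x y = b y x.

(** Exchanging the two ends of each edge gives summation by parts. No boundary term arises, because
    both sums run over the same sequence. *)
Lemma energy_green s f g : energy s f g = \sum_(x <- s) g x * lapl_on s f x.
Proof.
rewrite /energy /lapl_on.
under [RHS]eq_bigr do rewrite mulrDr.
rewrite big_split/=; congr (_ + _); last by apply: eq_bigr => x _; ring.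
apply: (@mulIf _ (2 : R)) => //; rewrite divfK// mulr_natr mulr2n.
under [in RHS]eq_bigr do rewrite mulr_sumr.
rewrite {2}[in RHS]sum2_sym -big_split/=; apply: eq_bigr => x _.
rewrite -big_split/=; apply: eq_bigr => y _; rewrite (bsym y x); ring.
Qed.

Hypothesis b0 : forall x y, 0 <= b x y.

(** Averaging over both orientations of an edge replaces [F x] by the mean of [F x] and [F y]. *)
Lemma sum_grad_on s f (F : X -> R) :
  \sum_(x <- s) F x * grad_on s f x =
  (\sum_(x <- s) \sum_(y <- s) b x y * ((F x + F y) / 2 * (f x - f y) ^+ 2)) / 2.
Proof.
apply: (@mulIf _ (2 : R)) => //; rewrite divfK//.
have E : \sum_(x <- s) F x * grad_on s f x * 2 =
   \sum_(x <- s) \sum_(y <- s) F x * (b x y * (f x - f y) ^+ 2).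
  by apply: eq_bigr => x _; rewrite -mulrA divfK// mulr_sumr.
rewrite mulr_suml E; apply: (@mulIf _ (2 : R)) => //.
rewrite mulr_natr mulr2n {2}sum2_sym -big_split/= mulr_suml.
apply: eq_bigr => x _; rewrite -big_split/= mulr_suml.
by apply: eq_bigr => y _; rewrite (bsym y x); field.
Qed.

(* The carre-du-champ identity with v x * v y <= (v x ^ 2 + v y ^ 2) / 2. *)
Lemma energy_mul_le s v psi :
  energy s (v \* psi) (v \* psi) <=
  energy s v (fun x => v x * psi x ^+ 2) + \sum_(x <- s) v x ^+ 2 * grad_on s psi x.
Proof.
rewrite sum_grad_on /energy addrAC lerD//; last first.
  by apply: ler_sum => x _ /=; rewrite le_eqVlt; apply/orP; left; apply/eqP; ring.
rewrite -mulrDl ler_pM2r// -big_split/=; apply: ler_sum => x _.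
rewrite -big_split/=; apply: ler_sum => y _; rewrite -mulrDr ler_wpM2l// -subr_ge0.
set e := (X in 0 <= X).
have -> : e = (v x - v y) ^+ 2 / 2 * (psi x - psi y) ^+ 2 by rewrite /e; field.
by rewrite mulr_ge0 ?divr_ge0 ?sqr_ge0.
Qed.

End FiniteEnergy.

(** * Energies on a graph, truncation and cutoff *)

Definition potential {R : realType} {X : countType} (m q : X -> R) (x : X) : R :=
  q x * m x.

Section GraphEnergy.
Context {R : realType} {X : countType}.
Variables (b : X -> X -> R) (m q : X -> R).
Hypotheses (hm : forall x, 0 < m x) (hb : is_graph b) (hlf : locally_finite b).
Implicit Types (f g u v phi psi : X -> R) (s t : seq X) (A : set X).

Let bsym := graph_sym hb.
Let b0 := graph_ge0 hb.
Local Notation p := (potential m q).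

Lemma nbhd_seq_exists A : finite_set A -> exists s, nbhd_seq b A s.
Proof.
move=> fA.
have : finite_set (A `|` \bigcup_(x in A) [set y | 0 < b x y]).
  by rewrite finite_setU; split=> //; apply: bigcup_finite => // x _; exact: hlf.
case/finite_set_uniq => s us sE; exists s; split=> // x Ax; split.
  by apply/sE; left.
by move=> y bxy; apply/sE; right; exists x => //=; rewrite lt0r bxy b0.
Qed.

(** The terms are nonnegative, so a pointwise gradient bound passes to every finite sequence,
    whether or not it contains the neighbours of [x]. *)
Lemma grad_on_le_gradsq s f x (c : R) : uniq s ->
  (gradsq b m f x <= c%:E)%E -> grad_on b s f x <= c * m x.
Proof.
move=> us; rewrite /gradsq => H.
have : ((2 * m x)^-1%:E * \sum_(y <- s) (b x y * (f x - f y) ^+ 2)%:E <= c%:E)%E.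
  apply: le_trans H; rewrite lee_pmul2l ?lte_fin ?invr_gt0 ?mulr_gt0//.
  exact: esum_ge_seq.
rewrite sumEFin lee_fin /grad_on.
by rewrite invfM mulrC mulrA ler_pdivrMr.
Qed.

Lemma gradsq_seq s f x : uniq s ->
  (forall y, b x y != 0 -> f x != f y -> y \in s) ->
  gradsq b m f x = (grad_on b s f x / m x)%:E.
Proof.
move=> us H; rewrite /gradsq (@esum_seq _ _ s)//.
- by rewrite -EFinM /grad_on; congr _%:E; rewrite invfM; ring.
- by move=> y; rewrite mulr_ge0// sqr_ge0.
- move=> y ys; apply/eqP; rewrite mulf_eq0 sqrf_eq0 subr_eq0.
  apply: contraNT ys; rewrite negb_or => /andP[]; exact: H.
Qed.

(** This holds for [x] outside [s] as well: if [phi x = 0], only neighbours in the support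
    contribute, and these lie in [s]. *)
Lemma gradsq_nbhd s phi x : nbhd_seq b (supp phi) s ->
  gradsq b m phi x = (grad_on b s phi x / m x)%:E.
Proof.
move=> [us H]; apply: gradsq_seq => // y bxy.
have [->|px] := eqVneq (phi x) 0; last by have [_ h] := H _ px; move=> _; apply: h.
by rewrite eq_sym => /H[].
Qed.

Lemma hform_energy s phi : nbhd_seq b (supp phi) s ->
  hform b m q phi = energy b p s phi phi.
Proof.
move=> [us H].
have phis x : x \notin s -> phi x = 0.
  by move=> xs; apply/eqP; apply: contraNT xs => /H[].
have gE x : fine (gradsq b m phi x) = grad_on b s phi x / m x.
  by rewrite (gradsq_nbhd x (conj us H)).
rewrite /hform (@sumX_seq _ _ s)// => [|x xs].
  rewrite energy_diag; apply: eq_bigr => x _; rewrite gE /potential mulrDl divfK ?gt_eqF//.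
  by rewrite mulrAC.
(* Outside [s] the gradient vanishes too: a neighbour of [x] in the support of [phi] would force [x]
   into [s]. *)
rewrite gE phis// expr0n/= mulr0 addr0 divfK ?gt_eqF// /grad_on big1 ?mul0r// => y _.
apply/eqP; rewrite mulf_eq0 sqrf_eq0 subr_eq0 phis//.
have [//|bxy/=] := eqVneq (b x y) 0.
rewrite eq_sym; apply: contraNT xs => /H[_]; apply; by rewrite bsym.
Qed.

Lemma sumX_sqr_seq s phi w : nbhd_seq b (supp phi) s ->
  sumX (fun x => w x * phi x ^+ 2 * m x) = \sum_(x <- s) w x * phi x ^+ 2 * m x.
Proof.
move=> [us H]; apply: sumX_seq => // x xs.
have -> : phi x = 0 by apply/eqP; apply: contraNT xs => /H[].
by rewrite expr0n/= mulr0 mul0r.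
Qed.

Lemma Hformal_seq s u x : uniq s -> (forall y, b x y != 0 -> y \in s) ->
  m x * Hformal b m q u x = lapl_on b p s u x.
Proof.
move=> us H; rewrite /Hformal (@sumX_seq _ _ s)//.
  by rewrite mulrDr mulVKf ?gt_eqF// /lapl_on /potential; congr (_ + _); ring.
by move=> y ys; apply/eqP; rewrite mulf_eq0; apply/orP; left; apply: contraNT ys => /H.
Qed.

Lemma hform_ge_seq w A s phi : hform_ge b m q w A ->
  finite_set (supp phi) -> supp phi `<=` A -> nbhd_seq b (supp phi) s ->
  \sum_(x <- s) w x * phi x ^+ 2 * m x <= energy b p s phi phi.
Proof.
by move=> H fphi sphi ns; rewrite -hform_energy// -sumX_sqr_seq//; apply: H.
Qed.

End GraphEnergy.

(** * Gradients of truncated functions and of functions cut off on a finite set *)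

Section Cutoff.
Context {R : realType} {X : countType}.
Variables (b : X -> X -> R).
Hypotheses (hb : is_graph b).
Implicit Types (f g u v phi psi : X -> R) (s t : seq X) (A K : set X).
Let bsym := graph_sym hb.
Let b0 := graph_ge0 hb.

Lemma le_grad_on s f g x (c : R) : 0 <= c ->
  (forall y, b x y != 0 -> (f x - f y) ^+ 2 <= c * (g x - g y) ^+ 2) ->
  grad_on b s f x <= c * grad_on b s g x.
Proof.
move=> c0 H; rewrite mulrA ler_pM2r ?invr_gt0// mulr_sumr; apply: ler_sum => y _.
have [->|bxy] := eqVneq (b x y) 0; first by rewrite !mul0r mulr0.
by rewrite [leRHS]mulrCA ler_wpM2l// H.
Qed.

(* Where f > L, the increments of min f L are at most those of f shrunk by the
   factor L / f x, so a bound relative to f ^ 2 survives truncation. *)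
Lemma grad_on_min s f (L : R) x : (forall y, 0 <= f y) -> 0 <= L ->
  forall c, grad_on b s f x <= c * f x ^+ 2 ->
  grad_on b s (fun y => Num.min (f y) L) x <= c * Num.min (f x) L ^+ 2.
Proof.
move=> f0 L0 c H; have [fL|fL] := leP (f x) L.
  apply: le_trans H; rewrite -[leRHS]mul1r; apply: le_grad_on => // y _.
  rewrite mul1r (min_l fL); have [//|fy] := leP (f y) L.
  rewrite -subr_ge0; have -> : (f x - f y) ^+ 2 - (f x - L) ^+ 2 =
    (f y - L) * ((f y - f x) + (L - f x)) by ring.
  apply: mulr_ge0; lra.
have fx0 : 0 < f x by exact: le_lt_trans fL.
have : grad_on b s (fun y => Num.min (f y) L) x <=
    (L / f x) ^+ 2 * grad_on b s f x.
  apply: le_grad_on => [|y _]; first exact: sqr_ge0.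
  rewrite (min_r (ltW fL)) -exprMn; have [fy|fy] := leP (f y) L; last first.
    by rewrite subrr expr0n sqr_ge0.
  rewrite mulrBr divfK ?gt_eqF// ler_sqr ?nnegrE ?subr_ge0//.
  - by rewrite lerB// -[leRHS]mul1r ler_wpM2r// ler_pdivrMr// mul1r ltW.
  - rewrite -mulrA ler_piMr// mulrC ler_pdivrMr// mul1r. exact: le_trans (ltW fL).
move=> /le_trans; apply; apply: le_trans (ler_wpM2l (sqr_ge0 _) H) _.
by rewrite mulrCA -exprMn divfK ?gt_eqF// (min_r (ltW fL)).
Qed.

(* On a neighbourhood of K the gradient of a function vanishing on K is bounded
   by its boundary values alone, whatever their gradient was. *)
Lemma cutoff_bound K (P : X -> R) : locally_finite b -> finite_set K ->
  (forall x, 0 <= P x) ->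
  exists c : X -> R, [/\ forall x, 0 <= c x, finite_set (supp c) &
   forall G s x, uniq s -> (forall y, G y ^+ 2 <= P y) -> (forall y, 0 <= G y) ->
     let G' y := if y \in K then 0 else G y in
     (x \notin K /\ grad_on b s G' x = grad_on b s G x) \/ grad_on b s G' x <= c x].
Proof.
move=> lf fK P0.
have [k1 [uk1 Hk1]] := nbhd_seq_exists hb lf fK.
have [k2 [uk2 Hk2]] := nbhd_seq_exists hb lf (finite_seq k1).
(* Outside [k1] no neighbour lies in [K], so the cutoff changes nothing. On [k1] nonnegativity gives
   (G' x - G' y)^2 <= P x + P y, and [k2] contains all neighbours that occur. *)
pose c x := if x \in k1 then (\sum_(y <- k2) b x y * (P x + P y)) / 2 else 0.
exists c; split => [x||G s x us GP G0 G'].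
- rewrite /c; case: ifP => // _; rewrite divr_ge0// sumr_ge0// => y _.
  by rewrite mulr_ge0// addr_ge0.
- apply: (@sub_finite_set _ _ [set` k1]); last exact: finite_seq.
  by move=> x; rewrite /supp/= /c; case: ifP => //; rewrite eqxx.
have [xk|xk] := boolP (x \in k1); [right|left]; last first.
  have xK : x \notin K by apply: contra xk => /set_mem/Hk1[].
  split=> //; congr (_ / _); apply: eq_bigr => y _; rewrite /G' (negbTE xK).
  case: ifPn => // /set_mem yK; have [->|bxy] := eqVneq (b x y) 0; first by rewrite !mul0r.
  by have [_ /(_ x)] := Hk1 _ yK; rewrite bsym => /(_ bxy); rewrite (negbTE xk).
rewrite /c xk ler_pM2r ?invr_gt0//.
have F0 y : 0 <= b x y * (P x + P y) by rewrite mulr_ge0// addr_ge0.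
apply: (@le_trans _ _ (\sum_(y <- s) b x y * (P x + P y))); last first.
  apply: ler_sum_subseq => // y _; rewrite mulf_eq0 negb_or => /andP[bxy _].
  by have [_] := Hk2 _ xk; apply.
apply: ler_sum => y _; rewrite ler_wpM2l//.
have G'0 z : 0 <= G' z by rewrite /G'; case: ifP.
have G'P z : G' z ^+ 2 <= P z by rewrite /G'; case: ifP => // _; rewrite expr0n/=.
have := G'P x; have := G'P y; have := mulr_ge0 (G'0 x) (G'0 y); nra.
Qed.

End Cutoff.

(** * Passage to the limit *)

(** Using the index [N] itself as the level keeps the function bounded for each [N], while the
    truncation disappears pointwise as [N] grows. *)
Definition truncated_sqrt {R : realType} {X : countType} (gN : nat -> X -> R)
  (N : nat) (x : X) : R := Num.min (Num.sqrt (gN N x)) N%:R.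

Section Limits.
Context {R : realType} {X : countType}.

Lemma limn_einf_eventually (a : nat -> R) (l r : R) :
  limn_einf (fun n => (a n)%:E) = l%:E -> r < l ->
  exists n0, forall n, (n0 <= n)%N -> r < a n.
Proof.
move=> al rl.
have : (r%:E < ereal_sup (range (einfs (fun n => (a n)%:E))))%E.
  by rewrite -(cvg_lim _ (@cvg_einfs_sup _ _))// -limn_einf_lim al lte_fin.
case/ereal_sup_gt => _ [n0 _ <-] H; exists n0 => n nn0.
rewrite -lte_fin; apply: lt_le_trans H _.
by rewrite /einfs/=; apply: ereal_inf_lbound; exists n.
Qed.

(** The sequence [a] may fail to converge; its minimum with the lower limit does converge and still
    lies below [a], so upper bounds survive. *)
Lemma cvg_min_liminf (a : nat -> R) (l : R) :
  limn_einf (fun n => (a n)%:E) = l%:E ->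
  Num.min (a n) l @[n --> \oo] --> l.
Proof.
move=> al; apply/cvgrPdist_lt => e e0.

have [n0 H] : exists n0, forall n, (n0 <= n)%N -> l - e < a n.
  by apply: limn_einf_eventually al _; rewrite ltrBlDr ltrDl.
exists n0 => // n /= /H la; case: (leP (a n) l) => al'; last by rewrite subrr normr0.
by rewrite ger0_norm ?subr_ge0// ltrBlDr addrC -ltrBlDr.
Qed.

(** Since [Num.sqrt (gn n) <= Num.sqrt l], the truncation at [n] is inactive for large [n]. *)
Lemma truncated_sqrt_cvg (gn : nat -> R) (l : R) :
  (forall n, 0 <= gn n <= l) -> gn n @[n --> \oo] --> l ->
  Num.min (Num.sqrt (gn n)) n%:R ^+ 2 @[n --> \oo] --> l.
Proof.
move=> g0 gl; apply: cvg_trans gl; apply: near_eq_cvg.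
have [n0 H] : exists n0 : nat, Num.sqrt l <= n0%:R.
  exists (Num.truncn (Num.sqrt l)).+1; apply: ltW.
  exact: truncnS_gt.
exists n0 => // n /= nn0; have /andP[gn0 gnl] := g0 n.
rewrite min_l ?sqr_sqrtr//; apply: (@le_trans _ _ (Num.sqrt l)).
  by rewrite ler_wsqrtr.
by apply: le_trans H _; rewrite ler_nat.
Qed.

Lemma sum_le_of_limit (F : nat -> X -> R) (f : X -> R) (s : seq X) (B : R) (N1 : nat) :
  (forall x, x \in s -> F n x @[n --> \oo] --> f x) ->
  (forall n, (N1 <= n)%N -> \sum_(x <- s) F n x <= B) -> \sum_(x <- s) f x <= B.
Proof.
move=> Ff FB; apply: (cvgr_to_le (cvg_sum_seq Ff)).
by exists N1 => // n /=; exact: FB.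
Qed.

Variables (K : set X) (m g w u : X -> R) (wN gN : nat -> X -> R).
Hypotheses (fK : finite_set K) (hm : forall x, 0 < m x)
  (hgN : forall N x, 0 <= gN N x <= g x)
  (hgN_cvg : forall x, gN N x @[N --> \oo] --> g x)
  (hw : forall x, limn_einf (fun N => (wN N x)%:E) = (w x)%:E).

Local Notation trunc := (truncated_sqrt gN).

(** The finite set [K] contributes at most the fixed sum [B']. Off [K], [wN] is lowered to its
    minimum with [w] and [N] tends to infinity on each finite sequence; [B] does not depend on [N]
    or on the sequence. *)
Lemma l2_of_bound (B : R) (N1 : nat) :
  (forall N t, (N1 <= N)%N -> uniq t -> (forall x, x \in t -> x \notin K) ->
    \sum_(x <- t) wN N x * u x ^+ 2 * trunc N x ^+ 2 * m x <= B) ->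
  l2 [set: X] (fun x => g x * w x * m x) u.
Proof.
move=> H; have [k uk kE] := finite_set_uniq fK.
pose B' := \sum_(x <- k) `|u x ^+ 2 * (g x * w x * m x)|.
rewrite /l2; apply: (@le_lt_trans _ _ (B' + B)%:E); last exact: ltry.
apply: esum_le_seq => s us _; rewrite sumEFin lee_fin.
rewrite (bigID (fun x => x \in K))/= lerD//.
  rewrite -big_filter; apply: (@le_trans _ _ (\sum_(x <- [seq x <- s | x \in K])
    `|u x ^+ 2 * (g x * w x * m x)|)).
    by apply: ler_sum => x _; exact: ler_norm.
  apply: ler_sum_subseq => //; first by rewrite filter_uniq.
  by move=> x; rewrite mem_filter => /andP[/set_mem xK _] _; apply/kE.
rewrite -big_filter.
apply: (@sum_le_of_limit
  (fun N x => Num.min (wN N x) (w x) * u x ^+ 2 * trunc N x ^+ 2 * m x) _ _ _ N1).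
- move=> x _; rewrite (_ : u x ^+ 2 * _ = w x * u x ^+ 2 * g x * m x); last by ring.
  apply: cvgMr_tmp; apply: cvgM; first by apply: cvgMr_tmp; exact: cvg_min_liminf.
  exact: truncated_sqrt_cvg.
- move=> N N1N; apply: le_trans (H N [seq x <- s | x \notin K] N1N _ _).
  + apply: ler_sum => x _; rewrite ler_wpM2r ?(ltW (hm _))//.
    rewrite ler_wpM2r ?sqr_ge0// ler_wpM2r ?sqr_ge0//.
    by rewrite ge_min lexx.
  + by rewrite filter_uniq.
  + by move=> x; rewrite mem_filter => /andP[].
Qed.

(** The order of limits: for fixed [N], the approximations [v n], which may depend on [N], tend to
    [u] and the error [e] is removed. The limiting right side is the same for all [N]. *)
Lemma l2_of_approximate_bound (theta A : R) (a : X -> R) (k : seq X) (N1 : nat) :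
  0 < theta ->
  (forall N, (N1 <= N)%N -> exists2 v : nat -> X -> R,
    forall x, v n x @[n --> \oo] --> u x &
    forall e, 0 < e -> exists n0, forall n t, (n0 <= n)%N -> uniq t ->
     (forall x, x \in t -> x \notin K) ->
     theta * \sum_(x <- t) wN N x * v n x ^+ 2 * trunc N x ^+ 2 * m x <=
       \sum_(x <- k) a x * v n x ^+ 2 + A + e) ->
  l2 [set: X] (fun x => g x * w x * m x) u.
Proof.
move=> theta0 H.
apply: (@l2_of_bound (theta^-1 * (\sum_(x <- k) a x * u x ^+ 2 + A)) N1).
move=> N t N1N ut tK; rewrite ler_pdivlMl//.
have [v vu vB] := H N N1N.
apply/ler_addgt0Pr => e e0; have [n0 {}vB] := vB _ e0.
apply: (@ler_cvg_to _ \oo _ _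
  (fun n => theta * \sum_(x <- t) wN N x * v n x ^+ 2 * trunc N x ^+ 2 * m x)
  (fun n => \sum_(x <- k) a x * v n x ^+ 2 + A + e)).
- apply: cvgMl_tmp; apply: cvg_sum_seq => x _.
  apply: cvgMr_tmp; apply: cvgMr_tmp; apply: cvgMl_tmp; exact: cvgM.
- apply: cvgD (cvg_cst _); apply: cvgD (cvg_cst _); apply: cvg_sum_seq => x _.
  by apply: cvgMl_tmp; exact: cvgM.
- by exists n0 => // n /= n0n; exact: vB.
Qed.

End Limits.

(** * Agmon estimate for cutoff functions *)

Section GradientProducts.
Context {R : realType} {X : countType}.
Variable b : X -> X -> R.
Hypothesis b0 : forall x y, 0 <= b x y.
Implicit Types (f g phi : X -> R) (s : seq X).

(** The increment of the product is g x (f x - f y) + f y (g x - g y), and Young's inequality with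
    [delta] splits its square. A small [delta] keeps the first constant near 1, which the absorption
    with gamma < 1 requires. *)
Lemma grad_on_mul_le s f g x (L delta : R) : 0 < delta ->
  (forall y, `|f y| <= L) ->
  grad_on b s (f \* g) x <= (1 + delta) * g x ^+ 2 * grad_on b s f x +
     (1 + delta^-1) * L ^+ 2 * grad_on b s g x.
Proof.
move=> d0 fL; rewrite /grad_on !mulrA -mulrDl ler_pM2r ?invr_gt0//.
rewrite !mulr_sumr -big_split/=; apply: ler_sum => y _.
rewrite [X in _ <= X + _]mulrCA [X in _ <= _ + X]mulrCA -mulrDr ler_wpM2l//.
have fL2 : f y ^+ 2 <= L ^+ 2.
  by rewrite -(real_normK (num_real (f y))) lerXn2r ?nnegrE// (le_trans _ (fL y)).
set A := g x * (f x - f y); set B := f y * (g x - g y).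
have -> : f x * g x - f y * g y = A + B by rewrite /A /B; ring.
apply: (@le_trans _ _ ((1 + delta) * A ^+ 2 + (1 + delta^-1) * B ^+ 2)).
  rewrite -subr_ge0.
  have -> : (1 + delta) * A ^+ 2 + (1 + delta^-1) * B ^+ 2 - (A + B) ^+ 2
     = (delta * A - B) ^+ 2 / delta by field; rewrite gt_eqF.
  by rewrite divr_ge0 ?sqr_ge0// ltW.
rewrite -subr_ge0; set e := (X in 0 <= X).
have -> : e = (1 + delta^-1) * (g x - g y) ^+ 2 * (L ^+ 2 - f y ^+ 2).
  by rewrite /e /A /B; ring.
apply: mulr_ge0; last by rewrite subr_ge0.
by apply: mulr_ge0; [rewrite addr_ge0// invr_ge0 ltW|exact: sqr_ge0].
Qed.

(** The product rule with [delta = 1]. The sign of [p] serves to bound the potential term by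
    [L ^+ 2], so the estimate is applied to the positive part of [q]. *)
Lemma energy_mul_bound (p : X -> R) s f g (L : R) :
  (forall x y, b x y = b y x) -> (forall x, 0 <= p x) -> (forall y, `|f y| <= L) ->
  energy b p s (f \* g) (f \* g) <=
   2 * L ^+ 2 * energy b p s g g + 2 * \sum_(x <- s) g x ^+ 2 * grad_on b s f x.
Proof.
move=> bsym p0 fL; rewrite !energy_diag.
rewrite !mulr_sumr -big_split/=; apply: ler_sum => x _.
have := grad_on_mul_le s g x ltr01 fL; rewrite invr1.
have fL2 : f x ^+ 2 <= L ^+ 2.
  by rewrite -(real_normK (num_real (f x))) lerXn2r ?nnegrE// (le_trans _ (fL x)).
have : 0 <= p x * g x ^+ 2 by rewrite mulr_ge0// sqr_ge0.
have : p x * g x ^+ 2 * f x ^+ 2 <= p x * g x ^+ 2 * L ^+ 2.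
  by rewrite ler_wpM2l// mulr_ge0// sqr_ge0.
rewrite exprMn; have := sqr_ge0 L.
set e := grad_on _ _ _ _; set e1 := grad_on _ _ _ _; set e2 := grad_on _ _ _ _.
move=> L0 H1 H2 H3; nra.
Qed.

End GradientProducts.

(** * The weighted estimate for [u] times a finitely supported cutoff *)

Section AgmonEstimate.
Context {R : realType} {X : countType}.
Variables (b : X -> X -> R) (m q : X -> R).
Hypotheses (hm : forall x, 0 < m x) (hb : is_graph b).
Variables (K : set X) (W : X -> R).
Hypothesis hW : hform_ge b m q W (~` K).
Variables (G : X -> R) (L gamma : R) (c : X -> R).
Hypotheses (hG0 : forall x, 0 <= G x) (hGL : forall x, G x <= L)
  (hGK : forall x, x \in K -> G x = 0)
  (hgrad : forall s x, uniq s ->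
     grad_on b s G x <= gamma * W x * G x ^+ 2 * m x + c x).
(** Both kinds of source fit [hf]: a finitely supported [f] uses [eta = 0] with finitely supported
    [a], a weighted l^2 source uses [a = 0] with [eta > 0]. Here [r] stands for a value of the
    approximation of [u]. *)
Variables (f a al : X -> R) (eta A : R).
Hypotheses
  (hf : forall x r, `|f x| * `|r| * G x ^+ 2 * m x <=
      eta * (W x * r ^+ 2 * G x ^+ 2 * m x) + a x * r ^+ 2 + al x)
  (hal : forall s, uniq s -> \sum_(x <- s) al x <= A).

Let bsym := graph_sym hb.
Let b0 := graph_ge0 hb.
Local Notation p := (potential m q).

Lemma finite_supp_mul (u v : X -> R) : finite_set (supp v) -> finite_set (supp (u \* v)).
Proof.
apply: sub_finite_set => x; rewrite /supp/= mulf_eq0 negb_or => /andP[]//.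
Qed.

Lemma nbhd_seq_mul s (u v : X -> R) :
  nbhd_seq b (supp v) s -> nbhd_seq b (supp (u \* v)) s.
Proof.
apply: nbhd_seq_sub => x; rewrite /supp/= mulf_eq0 negb_or => /andP[]//.
Qed.

(** As [psi] vanishes on [K], the product [v psi] may be inserted into h >= W; the product
    inequality for energies then moves both factors [psi] to one side. *)
Lemma weight_le_energy s v psi : finite_set (supp (v \* psi)) ->
  nbhd_seq b (supp (v \* psi)) s -> (forall x, x \in K -> psi x = 0) ->
  \sum_(x <- s) W x * (v x * psi x) ^+ 2 * m x <=
    energy b p s v (fun x => v x * psi x ^+ 2)
    + \sum_(x <- s) v x ^+ 2 * grad_on b s psi x.
Proof.
move=> fv nv psiK; apply: le_trans (energy_mul_le p bsym b0 s v psi).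
apply: (hform_ge_seq hm hb hW fv _ nv) => x.
rewrite /supp/= mulf_eq0 negb_or => /andP[_ px] xK.
by rewrite (psiK _ (mem_set xK)) eqxx in px.
Qed.

(** Only [phi] has to be finitely supported, so [v] may be the function [u] itself. *)
Lemma energy_Hformal s v phi : nbhd_seq b (supp phi) s ->
  energy b p s v phi = \sum_(x <- s) phi x * (m x * Hformal b m q v x).
Proof.
move=> [us H]; rewrite (energy_green _ bsym); apply: eq_bigr => x _.
have [->|px] := eqVneq (phi x) 0; first by rewrite !mul0r.
by congr (_ * _); rewrite (@Hformal_seq _ _ _ _ _ hm s)//; have [] := H _ px.
Qed.

(* For a positive subsolution as well as for a solution, [u * H u <= |f| |u|]. *)
Lemma agmon_cutoff s u phi (delta : R) : 0 < delta ->
  finite_set (supp phi) -> nbhd_seq b (supp phi) s ->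
  (forall x, 0 <= phi x <= 1) ->
  (forall x, u x * Hformal b m q u x <= `|f x| * `|u x|) ->
  (1 - (1 + delta) * gamma - eta) *
    \sum_(x <- s) W x * (u x * phi x) ^+ 2 * G x ^+ 2 * m x <=
  \sum_(x <- s) ((1 + delta) * c x + a x) * (u x * phi x) ^+ 2 + A
  + (1 + delta^-1) * L ^+ 2 * \sum_(x <- s) u x ^+ 2 * grad_on b s phi x.
Proof.
move=> d0 fphi nphi phi01 hu; have us := nphi.1.
(* The cutoff [phi] is grouped with the weight, not with [u], so that Green's formula produces
   [Hformal] of [u] itself. *)
pose psi := G \* phi.
have sub : supp (u \* psi) `<=` supp phi.
  by move=> x; rewrite /supp/= !mulf_eq0 !negb_or => /and3P[].
have psiK x : x \in K -> psi x = 0 by move=> xK; rewrite /psi/= hGK// mul0r.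
have H := weight_le_energy (sub_finite_set sub fphi) (nbhd_seq_sub sub nphi) psiK.
rewrite (_ : \sum_(x <- s) W x * (u x * psi x) ^+ 2 * m x =
   \sum_(x <- s) W x * (u x * phi x) ^+ 2 * G x ^+ 2 * m x) in H; last first.
  by apply: eq_bigr => x _; rewrite /psi/=; ring.
rewrite energy_Hformal in H; last first.
  apply: nbhd_seq_sub nphi => x; rewrite /supp/= mulf_eq0 expf_eq0/= !mulf_eq0.
  by rewrite !negb_or => /and3P[].
have H1 : \sum_(x <- s) u x * psi x ^+ 2 * (m x * Hformal b m q u x) <=
  eta * (\sum_(x <- s) W x * (u x * phi x) ^+ 2 * G x ^+ 2 * m x)
  + \sum_(x <- s) a x * (u x * phi x) ^+ 2 + A.
  apply: (@le_trans _ _ (\sum_(x <- s) (eta * (W x * (u x * phi x) ^+ 2 * G x ^+ 2 * m x)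
     + a x * (u x * phi x) ^+ 2 + al x))); last first.
    by rewrite !big_split/= -mulr_sumr lerD2l hal.
  apply: ler_sum => x _; apply: le_trans (hf x (u x * phi x)).
  have /andP[p0 p1] := phi01 x; rewrite /psi/= normrM (ger0_norm p0).
  have k0 : 0 <= (G x * phi x) ^+ 2 * m x by rewrite mulr_ge0 ?sqr_ge0// ltW.
  apply: (@le_trans _ _ (`|f x| * `|u x| * ((G x * phi x) ^+ 2 * m x))).
    rewrite [leLHS](_ : _ = u x * Hformal b m q u x * ((G x * phi x) ^+ 2 * m x)).
      by rewrite ler_wpM2r.
    by ring.
  rewrite [leRHS](_ : _ = `|f x| * `|u x| * (G x ^+ 2 * phi x * m x)); last by ring.
  rewrite ler_wpM2l ?mulr_ge0// ler_wpM2r ?(ltW (hm _))// exprMn.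
  by rewrite ler_wpM2l ?sqr_ge0// expr2 ler_piMr.
have H2 : \sum_(x <- s) u x ^+ 2 * grad_on b s psi x <=
  (1 + delta) * gamma * (\sum_(x <- s) W x * (u x * phi x) ^+ 2 * G x ^+ 2 * m x)
  + \sum_(x <- s) (1 + delta) * c x * (u x * phi x) ^+ 2
  + (1 + delta^-1) * L ^+ 2 * \sum_(x <- s) u x ^+ 2 * grad_on b s phi x.
  rewrite !mulr_sumr -!big_split/=; apply: ler_sum => x _.
  have GL y : `|G y| <= L by rewrite ger0_norm.
  have := ler_wpM2l (sqr_ge0 (u x)) (grad_on_mul_le b0 s phi x d0 GL).
  move=> /le_trans; apply.
  have d1 : 0 <= 1 + delta by rewrite addr_ge0// ltW.
  have := ler_wpM2l (mulr_ge0 d1 (sqr_ge0 (u x * phi x))) (hgrad x us).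
  move=> h; rewrite -subr_ge0; rewrite -subr_ge0 in h.
  apply: le_trans h _; rewrite le_eqVlt; apply/orP; left; apply/eqP; ring.
have -> : \sum_(x <- s) ((1 + delta) * c x + a x) * (u x * phi x) ^+ 2 =
    \sum_(x <- s) (1 + delta) * c x * (u x * phi x) ^+ 2
    + \sum_(x <- s) a x * (u x * phi x) ^+ 2.
  by rewrite -big_split/=; apply: eq_bigr => x _; rewrite mulrDl.
set T := \sum_(x <- s) W x * (u x * phi x) ^+ 2 * _ * _ in H H1 H2 *.
set E := _ * \sum_(x <- s) u x ^+ 2 * grad_on b s phi x in H2 *.
rewrite -subr_ge0 in H; rewrite -subr_ge0 in H1; rewrite -subr_ge0 in H2.
rewrite -subr_ge0; apply: le_trans (addr_ge0 H (addr_ge0 H1 H2)) _.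
by rewrite le_eqVlt; apply/orP; left; apply/eqP; ring.
Qed.

End AgmonEstimate.

(** * Convergence in the form norm *)

Lemma cvge0_lt {R : realType} (F : nat -> \bar R) (e : R) :
  F n @[n --> \oo] --> 0%E -> 0 < e ->
  exists n0, forall n, (n0 <= n)%N -> (F n < e%:E)%E.
Proof.
move=> /fine_cvgP[[n1 _ fin] /cvgrPdist_lt/[swap] e0 /(_ _ e0)[n2 _ H]].
exists (maxn n1 n2) => n; rewrite geq_max => /andP[n1n n2n].
rewrite -(fineK (fin n n1n)) lte_fin.
by have := H n n2n; rewrite /= sub0r normrN; apply: le_lt_trans; exact: ler_norm.
Qed.

Section FormConvergence.
Context {R : realType} {X : countType}.
Variables (b : X -> X -> R) (m : X -> R).
Hypotheses (hm : forall x, 0 < m x) (hb : is_graph b) (hlf : locally_finite b).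
Implicit Types (q f g u phi psi : X -> R) (s t : seq X).

Let bsym := graph_sym hb.
Let b0 := graph_ge0 hb.
Local Notation pot := (potential m).

Lemma energyBl p s f f' g : energy b p s (f \- f') g = energy b p s f g - energy b p s f' g.
Proof.
rewrite -[f](_ : (f \- f') \+ f' = _); last by apply/funext => x /=; rewrite subrK.
rewrite [in RHS]energyDl addrK; congr energy.
by apply/funext => x /=; rewrite addrK.
Qed.

Lemma energyBr p s f g g' : energy b p s f (g \- g') = energy b p s f g - energy b p s f g'.
Proof. by rewrite energyC energyBl !(energyC _ _ _ _ f). Qed.

Lemma energyZr p s (c : R) f g :
  energy b p s f (fun x => c * g x) = c * energy b p s f g.
Proof. by rewrite energyC energyZl energyC. Qed.

(** Cauchy-Schwarz in Young's form, asking for positivity of the energy at a single combination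
    only. *)
Lemma energy_young p s f g (tau : R) :
  0 <= energy b p s ((fun x => tau * f x) \- g) ((fun x => tau * f x) \- g) ->
  2 * tau * energy b p s f g <= tau ^+ 2 * energy b p s f f + energy b p s g g.
Proof.
rewrite energyBl !energyBr !energyZl !energyZr (energyC b p s g f) => H.
rewrite -subr_ge0; apply: le_trans H _.
by rewrite le_eqVlt; apply/orP; left; apply/eqP; ring.
Qed.

Lemma energy_shift q s f g (C : R) :
  energy b (pot (fun x => q x + C)) s f g =
  energy b (pot q) s f g + C * \sum_(x <- s) f x * g x * m x.
Proof.
rewrite /energy -addrA; congr (_ + _); rewrite mulr_sumr -big_split/=.
by apply: eq_bigr => x _; rewrite /potential; ring.
Qed.

Lemma sqrB_le (x y : R) : (x - y) ^+ 2 <= 2 * x ^+ 2 + 2 * y ^+ 2.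
Proof. by have := sqr_ge0 (x + y); nra. Qed.

Lemma finite_suppU f g : finite_set (supp f) -> finite_set (supp g) ->
  finite_set (supp f `|` supp g).
Proof. by move=> ff fg; rewrite finite_setU. Qed.

Lemma supp_lincomb f g (tau : R) :
  supp ((fun x => tau * f x) \- g) `<=` supp f `|` supp g.
Proof.
move=> x; rewrite /supp/=; apply: contraPP => /not_orP[].
by move=> /negP/negPn/eqP -> /negP/negPn/eqP ->; rewrite mulr0 subrr eqxx.
Qed.

Variables (q : X -> R) (u : X -> R) (v : nat -> X -> R).
Hypotheses (hv : hconv b m q v u).

Let fv n : finite_set (supp (v n)). Proof. by have [/(_ n)[]] := hv. Qed.

Lemma hconv_l2 (e : R) : 0 < e -> exists n0, forall n s, (n0 <= n)%N -> uniq s ->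
  \sum_(x <- s) (v n x - u x) ^+ 2 * m x <= e.
Proof.
move=> e0; have [_ H _] := hv; have [n0 {}H] := cvge0_lt H e0.
exists n0 => n s n0n us; rewrite -lee_fin -sumEFin.
by apply: le_trans (ltW (H n n0n)); exact: esum_ge_seq.
Qed.

Lemma hconv_cvg x : v n x @[n --> \oo] --> u x.
Proof.
apply/cvgrPdist_le => e e0.
have me0 : 0 < e ^+ 2 * m x by rewrite mulr_gt0// exprn_gt0.
have [n0 H] := hconv_l2 me0; exists n0 => // n /= n0n.
have := H n [:: x] n0n isT; rewrite big_seq1 ler_pM2r//.
by rewrite -(real_normK (num_real _)) ler_sqr ?nnegrE ?(ltW e0)// distrC.
Qed.

Lemma hconv_cauchy (C e : R) : 0 <= C -> 0 < e ->
  exists n0, forall n k s, (n0 <= n)%N -> (n0 <= k)%N ->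
   nbhd_seq b (supp (v n) `|` supp (v k)) s ->
   energy b (pot (fun x => q x + C)) s (v n \- v k) (v n \- v k) <= e /\
   \sum_(x <- s) (v n x - v k x) ^+ 2 * m x <= e.
Proof.
move=> C0 e0.
(* Comparison with [u] bounds the l^2 part by [4 * e1], so the shift by [C] costs at most e / 2; the
   other e / 2 bounds h itself. *)
pose e1 := e / (8 * (C + 1)).
have C1 : 0 < 8 * (C + 1) by rewrite mulr_gt0// ltr_wpDl.
have e10 : 0 < e1 by rewrite divr_gt0.
have [n1 H1] := hconv_l2 e10.
have [_ _ /(_ _ (divr_gt0 e0 (ltr0Sn R 1)))[n2 H2]] := hv.
exists (maxn n1 n2) => n k s; rewrite !geq_max => /andP[n1n n2n] /andP[n1k n2k] ns.
have us := ns.1.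
have N : \sum_(x <- s) (v n x - v k x) ^+ 2 * m x <= 4 * e1.
  apply: (@le_trans _ _ (\sum_(x <- s) (2 * ((v n x - u x) ^+ 2 * m x)
     + 2 * ((v k x - u x) ^+ 2 * m x)))).
    apply: ler_sum => x _.
    have := ler_wpM2r (ltW (hm x)) (sqrB_le (v n x - u x) (v k x - u x)).
    rewrite (_ : v n x - u x - (v k x - u x) = v n x - v k x); last by ring.
    by rewrite mulrDl -!mulrA.
  rewrite big_split/= -!mulr_sumr.
  by have := H1 n s n1n us; have := H1 k s n1k us; lra.
have sub : supp (v n \- v k) `<=` supp (v n) `|` supp (v k).
  by move=> x xs; apply: (@supp_lincomb (v n) (v k) 1); move: xs; rewrite /supp/= mul1r.
have e1e : 8 * e1 + 8 * (C * e1) = e.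
  by rewrite /e1; field; rewrite gt_eqF// ltr_wpDl.
have Ce1 : 0 <= C * e1 by rewrite mulr_ge0// ltW.
split; last by lra.
have := H2 n k n2n n2k.
have ns' := nbhd_seq_sub sub ns.
rewrite (hform_energy q hm hb ns') energy_shift => /(le_lt_trans (ler_norm _)) H3.
have : C * \sum_(x <- s) (v n x - v k x) * (v n x - v k x) * m x <= C * (4 * e1).
  by rewrite ler_wpM2l//; under eq_bigr do rewrite -expr2.
rewrite -/(pot q) /= in H3 *; lra.
Qed.


(** The right side minus the left side is the energy of 2 g - f. *)
Lemma parallelogram_le p s f g :
  0 <= energy b p s ((fun x => 2 * g x) \- f) ((fun x => 2 * g x) \- f) ->
  energy b p s f f <= 2 * energy b p s (f \- g) (f \- g) + 2 * energy b p s g g.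
Proof.
move=> /energy_young; rewrite !energyBl !energyBr (energyC b p s g f).
rewrite -subr_ge0 => H; rewrite -subr_ge0; apply: le_trans H _.
by rewrite le_eqVlt; apply/orP; left; apply/eqP; ring.
Qed.

Lemma bounded_below_energy : bounded_below b m q ->
  exists2 C, 0 <= C & forall s phi, finite_set (supp phi) -> nbhd_seq b (supp phi) s ->
    0 <= energy b (pot (fun x => q x + C)) s phi phi.
Proof.
move=> [C H]; exists (Num.max C 0); first by rewrite le_max lexx orbT.
move=> s phi fphi ns; have := hform_ge_seq hm hb H fphi (@subsetT _ _) ns.
rewrite energy_shift -subr_ge0 => {}H.
have : 0 <= (Num.max C 0 - C) * \sum_(x <- s) phi x * phi x * m x.
  rewrite mulr_ge0 ?subr_ge0 ?le_max ?lexx// sumr_ge0// => x _.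
  by rewrite mulr_ge0 ?(ltW (hm _))// -expr2 sqr_ge0.
move: H; rewrite (_ : \sum_(x <- s) - C * phi x ^+ 2 * m x =
   - C * \sum_(x <- s) phi x * phi x * m x); first by rewrite /potential; lra.
by rewrite mulr_sumr; apply: eq_bigr => x _; ring.
Qed.

(** Writing h as the form of q_+ minus the q_- term, the condition V becomes eps h_{q_+} <= h + C,
    so h controls the gradient and the q_+ part together. *)
Lemma classV_energy : classV b m q -> exists k c, [/\ 0 < k, 0 < c &
  forall s phi, finite_set (supp phi) -> nbhd_seq b (supp phi) s ->
    energy b (pot q^\+) s phi phi <=
      k * energy b (pot q) s phi phi + c * \sum_(x <- s) phi x ^+ 2 * m x].
Proof.
move=> [eps [C [e0 C0 H]]]; exists eps^-1, (eps^-1 * C); split.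
- by rewrite invr_gt0.
- by rewrite mulr_gt0// invr_gt0.
move=> s phi fphi ns; have {H} := H phi (conj fphi (@subsetT _ _)).
rewrite (hform_energy _ hm hb ns) (sumX_sqr_seq m q^\- ns).
have -> : sumX (fun x => phi x ^+ 2 * m x) = \sum_(x <- s) phi x ^+ 2 * m x.
  have := sumX_sqr_seq m (fun=> 1) ns; under eq_bigr do rewrite mul1r.
  by under eq_fun do rewrite mul1r.
have -> : \sum_(x <- s) q^\- x * phi x ^+ 2 * m x =
    energy b (pot q^\+) s phi phi - energy b (pot q) s phi phi.
  rewrite !energy_diag -sumrB; apply: eq_bigr => x _.
  suff -> : q^\- x = q^\+ x - q x by rewrite /potential; ring.
  by rewrite /funrpos /funrneg; case: (leP (q x) 0) => ?; case: (leP (- q x) 0) => ?; lra.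
rewrite -mulrA -mulrDr ler_pdivlMl// /potential; lra.
Qed.

Hypotheses (hh : bounded_below b m q) (hV : classV b m q).

(** Each late [v n] is compared with one fixed [v n0] in the shifted, nonnegative form;
    [classV_energy] then converts the bound to the potential q_+. *)
Lemma hconv_bounded : exists D n0, 0 <= D /\ forall n s, (n0 <= n)%N ->
  nbhd_seq b (supp (v n)) s ->
  energy b (pot q^\+) s (v n) (v n) <= D /\ \sum_(x <- s) v n x ^+ 2 * m x <= D.
Proof.
have [C C0 HC] := bounded_below_energy hh.
have [k [c [k0 c0 HV]]] := classV_energy hV.
have [n0 H] := hconv_cauchy C0 ltr01.
have [s0 ns0] := nbhd_seq_exists hb hlf (fv n0).
pose E0 := hform b m (fun x => q x + C) (v n0).
pose N0 := sumX (fun x => 1 * v n0 x ^+ 2 * m x).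
have N00 : 0 <= N0.
  rewrite /N0 (sumX_sqr_seq _ _ ns0) sumr_ge0// => x _.
  by rewrite mul1r mulr_ge0 ?sqr_ge0// ltW.
have E00 : 0 <= E0 by rewrite /E0 (hform_energy _ hm hb ns0) HC.
exists (k * (2 + 2 * E0) + (c + 1) * (2 + 2 * N0)), n0; split.
  by rewrite addr_ge0// mulr_ge0 ?addr_ge0 ?mulr_ge0// ltW.
move=> n s n0n ns.
have fU := finite_suppU (fv n) (fv n0).
have [t nt] := nbhd_seq_exists hb hlf fU.
have ntn := nbhd_seq_sub (@subsetUl _ _ _) nt : nbhd_seq b (supp (v n)) t.
have ntn0 := nbhd_seq_sub (@subsetUr _ _ _) nt : nbhd_seq b (supp (v n0)) t.
have [H1 H2] := H n n0 t n0n (leqnn _) nt.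
have Nn : \sum_(x <- s) v n x ^+ 2 * m x <= 2 + 2 * N0.
  have e phi r : nbhd_seq b (supp phi) r ->
      \sum_(x <- r) phi x ^+ 2 * m x = sumX (fun x => 1 * phi x ^+ 2 * m x).
    move=> nr; rewrite (sumX_sqr_seq _ _ nr).
    by apply: eq_bigr => x _; rewrite mul1r.
  rewrite (e _ _ ns) -(e _ _ ntn).
  apply: (@le_trans _ _ (\sum_(x <- t) (2 * ((v n x - v n0 x) ^+ 2 * m x)
     + 2 * (v n0 x ^+ 2 * m x)))).
    apply: ler_sum => x _; rewrite !mulrA -mulrDl.
    apply: ler_wpM2r; first exact: ltW.
    by have := sqr_ge0 (v n x - 2 * v n0 x); nra.
  rewrite big_split/= -!mulr_sumr (e _ _ ntn0) -/N0; lra.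
have sub : supp ((fun x => 2 * v n0 x) \- v n) `<=` supp (v n) `|` supp (v n0).
  by apply: subset_trans (@supp_lincomb _ _ _) _; rewrite setUC.
have := parallelogram_le (HC t _ (sub_finite_set sub fU) (nbhd_seq_sub sub nt)).
rewrite -(hform_energy _ hm hb ntn0) -(hform_energy _ hm hb ntn) -/E0.
rewrite (hform_energy _ hm hb ns) (energy_shift _ _ (v n) (v n)) => H3.
have Nn0 : 0 <= \sum_(x <- s) v n x ^+ 2 * m x.
  by rewrite sumr_ge0// => x _; rewrite mulr_ge0 ?sqr_ge0// ltW.
have E2 : \sum_(x <- s) v n x * v n x * m x = \sum_(x <- s) v n x ^+ 2 * m x by [].
have CN := mulr_ge0 C0 Nn0.
have En : energy b (pot q) s (v n) (v n) <= 2 + 2 * E0 by rewrite E2 in H3; lra.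
split.
  apply: le_trans (HV s (v n) (fv n) ns) _.
  have := ler_wpM2l (ltW k0) En; have := ler_wpM2l (ltW c0) Nn; nra.
have kE := mulr_ge0 (ltW k0) E00; have cN := mulr_ge0 (ltW c0) N00.
apply: (le_trans Nn); lra.
Qed.

End FormConvergence.

(** * Agmon estimate in the form domain *)

Ltac nonneg :=
  by repeat first [done | exact: sqr_ge0 | apply: mulr_ge0 | apply: addr_ge0].

Section AgmonDomain.
Context {R : realType} {X : countType}.
Variables (b : X -> X -> R) (m q : X -> R).
Hypotheses (hm : forall x, 0 < m x) (hb : is_graph b) (hlf : locally_finite b).
Variables (K : set X) (W : X -> R).
Hypotheses (fK : finite_set K) (hW : hform_ge b m q W (~` K)) (hW0 : forall x, 0 <= W x).
Variables (G : X -> R) (L gamma : R) (c : X -> R).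
Hypotheses (hG0 : forall x, 0 <= G x) (hGL : forall x, G x <= L)
  (hGK : forall x, x \in K -> G x = 0)
  (hc : forall x, 0 <= c x) (fc : finite_set (supp c)) (hgamma : 0 <= gamma)
  (hgrad : forall s x, uniq s ->
     grad_on b s G x <= gamma * W x * G x ^+ 2 * m x + c x).
Variables (u : X -> R) (v : nat -> X -> R).
Hypotheses (hv : hconv b m q v u).
Hypotheses (hh : bounded_below b m q) (hV : classV b m q).

Let bsym := graph_sym hb.
Let b0 := graph_ge0 hb.
Local Notation pot := (potential m).
Let fv n : finite_set (supp (v n)). Proof. by have [/(_ n)[]] := hv. Qed.

Lemma hconv_local_bounded (a : X -> R) : (forall x, 0 <= a x) -> finite_set (supp a) ->
  exists D n0, 0 <= D /\ forall n s, (n0 <= n)%N -> uniq s ->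
    \sum_(x <- s) v n x ^+ 2 * a x <= D.
Proof.
move=> a0 /finite_set_uniq[k uk kE].
have : \sum_(x <- k) v n x ^+ 2 * a x @[n --> \oo] --> \sum_(x <- k) u x ^+ 2 * a x.
  apply: cvg_sum_seq => x _; apply: cvgMr_tmp; apply: cvgM; exact: (hconv_cvg hm hv).
move=> /cvgrPdist_lt/(_ _ ltr01)[n0 _ H].
exists (\sum_(x <- k) u x ^+ 2 * a x + 1), n0; split.
  by rewrite addr_ge0// sumr_ge0// => x _; rewrite mulr_ge0 ?sqr_ge0.
move=> n s n0n us; apply: (@le_trans _ _ (\sum_(x <- k) v n x ^+ 2 * a x)).
  apply: ler_sum_subseq => // x; first by nonneg.
  by move=> _; rewrite mulf_eq0 negb_or => /andP[_ ax]; apply/kE.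
have := H n n0n; rewrite /= distrC => /(le_lt_trans (ler_norm _)); lra.
Qed.

Let chi x : R := if x \in K then 0 else 1.

Lemma pos_part_energy s phi :
  energy b (pot q) s phi phi <= energy b (pot q^\+) s phi phi.
Proof.
rewrite !energy_diag; apply: ler_sum => x _; rewrite lerD2l ler_wpM2r ?sqr_ge0//.
rewrite /potential ler_wpM2r ?(ltW (hm _))// /funrpos le_max lexx//.
Qed.

Lemma pos_pot_ge0 x : 0 <= pot q^\+ x.
Proof. by rewrite mulr_ge0 ?(ltW (hm _))// /funrpos le_max lexx orbT. Qed.

(** The function [chi \* v n] vanishes on [K], so h >= W applies to it. Its energy is bounded
    because multiplying by [chi] adds only a gradient term of finite support. *)
Lemma hconv_weight_bounded : exists D n0, 0 <= D /\ forall n s, (n0 <= n)%N ->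
  nbhd_seq b (supp (v n)) s -> \sum_(x <- s) W x * (chi x * v n x) ^+ 2 * m x <= D.
Proof.
(* [chi] is the constant 1 cut off on [K], and the constant has zero gradient elsewhere. *)
have [c1 [c10 fc1 Hc1]] := cutoff_bound hb hlf fK (fun _ => ler01 : 0 <= 1 :> R).
have gchi s x : uniq s -> grad_on b s chi x <= c1 x.
  move=> us.
  have := Hc1 (fun=> 1) s x us (fun=> _) (fun=> ler01); rewrite expr1n => /(_ (fun=> lexx _)).
  case=> [[_ ->]|//]; rewrite /grad_on big1 ?mul0r// => y _.
  by rewrite subrr expr0n/= mulr0.
have [D1 [n1 [D10 H1]]] := hconv_bounded hm hb hlf hv hh hV.
have [D2 [n2 [D20 H2]]] := hconv_local_bounded c10 fc1.
exists (2 * D1 + 2 * D2), (maxn n1 n2); split.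
  by rewrite addr_ge0// mulr_ge0.
move=> n s; rewrite geq_max => /andP[n1n n2n] ns; have us := ns.1.
have [H3 _] := H1 n s n1n ns.
have fcv : supp (chi \* v n) `<=` ~` K.
  move=> x; rewrite /supp/= mulf_eq0 negb_or => /andP[cx _] xK.
  by move: cx; rewrite /chi (mem_set xK) eqxx.
have := hform_ge_seq hm hb hW (finite_supp_mul chi (fv n)) fcv (nbhd_seq_mul chi ns).
move=> /le_trans; apply; apply: (le_trans (pos_part_energy _ _)).
have chi1 x : `|chi x| <= 1 by rewrite /chi; case: ifP; rewrite ?normr0 ?normr1.
apply: le_trans (energy_mul_bound b0 s (v n) bsym pos_pot_ge0 chi1) _.
rewrite expr1n mulr1 lerD// ler_pM2l//.
apply: le_trans (H2 n s n2n us); apply: ler_sum => x _.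
by rewrite ler_wpM2l ?sqr_ge0// gchi.
Qed.

Let test n x := G x ^+ 2 * v n x.

Lemma L_ge0 (x : X) : 0 <= L.
Proof. exact: le_trans (hG0 x) (hGL x). Qed.

(** The gradient of G^2 is at most 2 L times that of G, which [hgrad] bounds by a multiple of W G^2
    plus [c]. The W part is controlled by [hconv_weight_bounded], the finitely supported [c] by
    pointwise convergence. *)
Lemma test_bounded : exists D n0, 0 <= D /\ forall n s, (n0 <= n)%N ->
  nbhd_seq b (supp (v n)) s ->
  energy b (pot q^\+) s (test n) (test n) <= D /\
  \sum_(x <- s) test n x ^+ 2 * m x <= D.
Proof.
have [D1 [n1 [D10 H1]]] := hconv_bounded hm hb hlf hv hh hV.
have [D2 [n2 [D20 H2]]] := hconv_local_bounded hc fc.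
have [D3 [n3 [D30 H3]]] := hconv_weight_bounded.
pose D := 2 * (L ^+ 2) ^+ 2 * D1 + 2 * (4 * L ^+ 2 * (gamma * L ^+ 2 * D3 + D2)).
have D0 : 0 <= D by rewrite /D; nonneg.
exists (D + (L ^+ 2) ^+ 2 * D1), (maxn n1 (maxn n2 n3)); split.
  by nonneg.
move=> n s; rewrite !geq_max => /and3P[n1n n2n n3n] ns; have us := ns.1.
have [E1 N1] := H1 n s n1n ns.
have := H2 n s n2n us; have := H3 n s n3n ns; move=> {}H3 {}H2.
have G2 x : `|G x ^+ 2| <= L ^+ 2.
  by rewrite ger0_norm ?sqr_ge0// lerXn2r ?nnegrE// (L_ge0 x).
have N4 : \sum_(x <- s) test n x ^+ 2 * m x <= (L ^+ 2) ^+ 2 * D1.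
  apply: le_trans (ler_wpM2l (sqr_ge0 _) N1); rewrite mulr_sumr.
  apply: ler_sum => x _; rewrite mulrA ler_wpM2r ?(ltW (hm _))// /test exprMn.
  by rewrite ler_wpM2r ?sqr_ge0// lerXn2r ?nnegrE ?sqr_ge0// (le_trans _ (G2 x))// ler_norm.
split; last by apply: (le_trans N4); rewrite lerDr.
suff : energy b (pot q^\+) s (test n) (test n) <= D.
  by move=> /le_trans; apply; rewrite lerDl mulr_ge0 ?sqr_ge0.
apply: le_trans (energy_mul_bound b0 s (v n) bsym pos_pot_ge0 G2) _.
apply: lerD; first by rewrite ler_wpM2l// mulr_ge0 ?sqr_ge0.
rewrite ler_pM2l//.
apply: (@le_trans _ _ (4 * L ^+ 2 * (gamma * L ^+ 2 *
   (\sum_(x <- s) W x * (chi x * v n x) ^+ 2 * m x) + \sum_(x <- s) v n x ^+ 2 * c x))).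
  rewrite !mulr_sumr -big_split/= mulr_sumr; apply: ler_sum => x _.
  have L0 := L_ge0 x.
  have gG2 : grad_on b s (fun x => G x ^+ 2) x <= 4 * L ^+ 2 * grad_on b s G x.
    apply: (le_grad_on hb) => [|y _]; first by nonneg.
    rewrite (_ : G x ^+ 2 - G y ^+ 2 = (G x + G y) * (G x - G y)); last by ring.
    rewrite exprMn ler_wpM2r ?sqr_ge0//.
    have -> : 4 * L ^+ 2 = (L + L) ^+ 2 by ring.
    by rewrite lerXn2r ?nnegrE ?addr_ge0// lerD.
  apply: le_trans (ler_wpM2l (sqr_ge0 (v n x)) gG2) _.
  rewrite [leLHS]mulrCA; apply: ler_wpM2l; first by nonneg.
  apply: le_trans (ler_wpM2l (sqr_ge0 (v n x)) (hgrad x us)) _.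
  rewrite mulrDr lerD2r.
  (* Because [G] vanishes on [K], the factor [chi] can be inserted, as the weighted bound on [v n]
     holds only off [K]. *)
  have GL : G x ^+ 2 <= L ^+ 2 * chi x ^+ 2.
    rewrite /chi; case: ifPn => [xK|_].
      by rewrite (hGK xK) expr0n/= mulr0.
    by rewrite expr1n mulr1 lerXn2r ?nnegrE.
  have k0 : 0 <= v n x ^+ 2 * (gamma * W x) * m x.
    by apply: mulr_ge0; [apply: mulr_ge0; [exact: sqr_ge0|exact: mulr_ge0]|exact: ltW].
  have := ler_wpM2l k0 GL; rewrite -subr_ge0 => h; rewrite -subr_ge0.
  by apply: le_trans h _; rewrite le_eqVlt; apply/orP; left; apply/eqP; ring.
apply: ler_wpM2l; first by nonneg.
by apply: lerD => //; apply: ler_wpM2l => //; nonneg.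
Qed.


Lemma sub_supp_test n : supp (test n) `<=` supp (v n).
Proof. by move=> x; rewrite /supp/= mulf_eq0 negb_or => /andP[]. Qed.

Lemma cvg_Hformal x : Hformal b m q (v n) x @[n --> \oo] --> Hformal b m q u x.
Proof.
have [s [us /(_ x erefl)[_ sx]]] := nbhd_seq_exists hb hlf (finite_set1 x).
have E g : Hformal b m q g x = (m x)^-1 * lapl_on b (pot q) s g x.
  by rewrite -(Hformal_seq q hm g us sx) mulKf// gt_eqF.
rewrite E; under eq_fun do rewrite E.
apply: cvgMl_tmp; apply: cvgD; last by apply: cvgMl_tmp; exact: (hconv_cvg hm hv).
apply: cvg_sum_seq => y _; apply: cvgMl_tmp.
by apply: cvgB; exact: (hconv_cvg hm hv).
Qed.

(* [test n] stays bounded in the form norm while [v n - v k] is small there, so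
   [v n] may be replaced by [v k], and then by [u] because the support of
   [test n] is finite. *)
Lemma energy_test_limit (e : R) : 0 < e -> exists n0, forall n s, (n0 <= n)%N ->
  nbhd_seq b (supp (v n)) s ->
  energy b (pot q) s (v n) (test n) <=
    \sum_(x <- s) test n x * (m x * Hformal b m q u x) + e.
Proof.
move=> e0.
have [C C0 HC] := bounded_below_energy hm hb hh.
have [D [n1 [D0 H1]]] := test_bounded.
(* In Young's inequality with parameter [tau], the terms free of v_n - v_k total at most D + 2 C D <
   M. The choice [tau = M / e] makes this less than [tau * e], and the tolerance e / tau / (C + 1)
   keeps the remaining terms within another [tau * e]. *)
pose M := D + 2 * (C * D) + 1.
have CD := mulr_ge0 C0 D0.
have M0 : 0 < M by rewrite /M; lra.
pose tau := M / e.
have tau0 : 0 < tau by rewrite divr_gt0.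
have e10 : 0 < e / tau / (C + 1) by rewrite !divr_gt0// ltr_wpDl.
have [n2 H2] := hconv_cauchy hm hb hv C0 e10.
set e1 := e / tau / (C + 1) in e10 H2.
have e1E : tau * e1 + tau * (C * e1) = e.
  by rewrite /e1; field; rewrite !gt_eqF// ltr_wpDl.
exists (maxn n1 n2) => n s; rewrite geq_max => /andP[n1n n2n] ns.
have nt := nbhd_seq_sub (@sub_supp_test n) ns.
rewrite (energy_Hformal q hm hb (v n) nt).
apply: (@cvgr_to_ge _ \oo _ _
  (fun k => \sum_(x <- s) test n x * (m x * Hformal b m q (v k) x) + e)).
  apply: cvgD; last exact: cvg_cst.
  apply: cvg_sum_seq => x _; apply: cvgMl_tmp; apply: cvgMl_tmp; exact: cvg_Hformal.
exists n2 => // k /= n2k.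
have [t nt'] := nbhd_seq_exists hb hlf (finite_suppU (fv n) (fv k)).
have ntn := nbhd_seq_sub (@subsetUl _ _ _) nt' : nbhd_seq b (supp (v n)) t.
have ntt := nbhd_seq_sub (@sub_supp_test n) ntn.
have E g : \sum_(x <- s) test n x * (m x * Hformal b m q g x) =
    energy b (pot q) t g (test n).
  rewrite (energy_Hformal q hm hb g ntt); apply: sum_seq_widen.
  - exact: ns.1.
  - exact: ntn.1.
  - by move=> x _; rewrite mulf_eq0 negb_or => /andP[/ntt.2[]].
  - by move=> x _; rewrite mulf_eq0 negb_or => /andP[/nt.2[]].
rewrite !E -lerBlDl -energyBl.
have [H3 H4] := H2 n k t n2n n2k nt'.
have [H5 H6] := H1 n t n1n ntn.
have fU := finite_suppU (fv n) (fv k).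
have sub : supp ((fun x => tau * (v n \- v k) x) \- test n) `<=` supp (v n) `|` supp (v k).
  move=> x; rewrite /supp/=; apply: contraPP => /not_orP[].
  move=> /negP/negPn/eqP v1 /negP/negPn/eqP v2.
  by rewrite /test v1 v2 !mulr0 subrr mulr0 subr0 eqxx.
have Y := energy_young (HC t _ (sub_finite_set sub fU) (nbhd_seq_sub sub nt')).
rewrite (@energy_shift _ _ b m q t (v n \- v k) (test n)) in Y.
rewrite (@energy_shift _ _ b m q t (test n) (test n)) in Y.
have Ep := pos_part_energy t (test n).
set I := \sum_(x <- t) (v n \- v k) x * test n x * m x in Y.
(* Positivity is known only for the shifted form; removing the shift from the mixed term needs a
   lower bound on [I], obtained from the square of tau (v_n - v_k) + test n. *)
have YI : - (2 * tau * I) <= tau ^+ 2 * e1 + D.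
  have : 0 <= \sum_(x <- t) (tau * (v n x - v k x) + test n x) ^+ 2 * m x.
    by apply: sumr_ge0 => x _; apply: mulr_ge0; [exact: sqr_ge0|exact: ltW].
  have -> : \sum_(x <- t) (tau * (v n x - v k x) + test n x) ^+ 2 * m x =
     tau ^+ 2 * (\sum_(x <- t) (v n x - v k x) ^+ 2 * m x) + 2 * tau * I
     + \sum_(x <- t) test n x ^+ 2 * m x.
    rewrite /I !mulr_sumr -!big_split/=; apply: eq_bigr => x _; ring.
  have := ler_wpM2l (sqr_ge0 tau) H4; lra.
have I2 : \sum_(x <- t) test n x * test n x * m x <= D by [].
have C1 := ler_wpM2l C0 YI; have C2 := ler_wpM2l C0 I2.
have C3 := ler_wpM2l (sqr_ge0 tau) H3.
rewrite -(ler_pM2l (mulr_gt0 (ltr0Sn R 1) tau0)).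
have Me : tau * e = M by rewrite /tau divfK// gt_eqF.
have T : tau ^+ 2 * e1 + C * (tau ^+ 2 * e1) = tau * e.
  by rewrite -e1E; ring.
rewrite -[2 * tau * e]mulrA Me; rewrite Me in T; rewrite /M in T *; lra.
Qed.

Variables (f a al : X -> R) (eta A : R).
Hypotheses
  (hf : forall x r, `|f x| * `|r| * G x ^+ 2 * m x <=
      eta * (W x * r ^+ 2 * G x ^+ 2 * m x) + a x * r ^+ 2 + al x)
  (hal : forall s, uniq s -> \sum_(x <- s) al x <= A)
  (hu : forall x, Hformal b m q u x = f x).

(** Since [v n] is itself finitely supported, [G] alone serves as weight and its gradient costs only
    gamma; replacing h(v_n, v_n G^2) by the source term costs [e]. *)
Lemma agmon_domain (e : R) : 0 < e -> exists n0, forall n s, (n0 <= n)%N ->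
  nbhd_seq b (supp (v n)) s ->
  (1 - gamma - eta) * \sum_(x <- s) W x * v n x ^+ 2 * G x ^+ 2 * m x <=
    \sum_(x <- s) (c x + a x) * v n x ^+ 2 + A + e.
Proof.
move=> /energy_test_limit[n0 H]; exists n0 => n s n0n ns.
have sub : supp (v n \* G) `<=` supp (v n).
  by move=> x; rewrite /supp/= mulf_eq0 negb_or => /andP[].
have := weight_le_energy hm hb hW (sub_finite_set sub (fv n)) (nbhd_seq_sub sub ns) hGK.
have -> : (fun x => v n x * G x ^+ 2) = test n.
  by apply/funext => x; rewrite /test mulrC.
have -> : \sum_(x <- s) W x * (v n x * G x) ^+ 2 * m x =
  \sum_(x <- s) W x * v n x ^+ 2 * G x ^+ 2 * m x.
  by apply: eq_bigr => x _; rewrite exprMn !mulrA.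
have {}H := H n s n0n ns.
have H1 : \sum_(x <- s) test n x * (m x * Hformal b m q u x) <=
   eta * (\sum_(x <- s) W x * v n x ^+ 2 * G x ^+ 2 * m x)
   + \sum_(x <- s) a x * v n x ^+ 2 + A.
  apply: (@le_trans _ _ (\sum_(x <- s) (eta * (W x * v n x ^+ 2 * G x ^+ 2 * m x)
     + a x * v n x ^+ 2 + al x))).
    apply: ler_sum => x _; apply: le_trans (hf x (v n x)).
    rewrite hu -normrM /test (_ : G x ^+ 2 * v n x * (m x * f x) =
      f x * v n x * (G x ^+ 2 * m x)); last by ring.
    rewrite -[leRHS]mulrA; apply: ler_wpM2r; last exact: ler_norm.
    by apply: mulr_ge0; [exact: sqr_ge0|exact: ltW].
  by rewrite !big_split/= -mulr_sumr lerD2l hal// ns.1.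
have H2 : \sum_(x <- s) v n x ^+ 2 * grad_on b s G x <=
   gamma * (\sum_(x <- s) W x * v n x ^+ 2 * G x ^+ 2 * m x)
   + \sum_(x <- s) c x * v n x ^+ 2.
  rewrite mulr_sumr -big_split/=; apply: ler_sum => x _.
  apply: le_trans (ler_wpM2l (sqr_ge0 (v n x)) (hgrad x ns.1)) _.
  by rewrite le_eqVlt; apply/orP; left; apply/eqP; ring.
have -> : \sum_(x <- s) (c x + a x) * v n x ^+ 2 =
    \sum_(x <- s) c x * v n x ^+ 2 + \sum_(x <- s) a x * v n x ^+ 2.
  by rewrite -big_split/=; apply: eq_bigr => x _; rewrite mulrDl.
lra.
Qed.

End AgmonDomain.

(** * Conclusion *)

Section AgmonL2.
Context {R : realType} {X : countType}.
Variables (b : X -> X -> R) (m q : X -> R) (K : set X) (wN gN : nat -> X -> R)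
  (gamma : R) (g w : X -> R).
Hypotheses (hm : forall x, 0 < m x) (hb : is_graph b) (hlf : locally_finite b)
  (hh : bounded_below b m q) (fK : finite_set K)
  (hwN0 : forall N x, 0 <= wN N x)
  (hwN : forall N, hform_ge b m q (wN N) (~` K))
  (hgamma : 0 < gamma < 1)
  (hgN : forall N x, 0 <= gN N x <= g x)
  (hgN_cvg : forall x, gN N x @[N --> \oo] --> g x).
Variable N0 : nat.
Hypotheses
  (hgrad : forall N : nat, (N0 <= N)%N -> forall x,
       (gradsq b m (fun y => Num.sqrt (gN N y)) x
          <= (gamma * gN N x * wN N x)%:E)%E)
  (hw : forall x, limn_einf (fun N => (wN N x)%:E) = (w x)%:E).

Local Notation trunc := (truncated_sqrt gN).
Let G N x := if x \in K then 0 else trunc N x.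

Lemma trunc_ge0 N x : 0 <= trunc N x.
Proof. by rewrite le_min sqrtr_ge0 ler0n. Qed.

Lemma trunc_sqr_le N x : trunc N x ^+ 2 <= gN N x.
Proof.
have /andP[g0 _] := hgN N x.
rewrite -[leRHS]sqr_sqrtr// lerXn2r ?nnegrE ?trunc_ge0 ?sqrtr_ge0//.
by rewrite /truncated_sqrt ge_min lexx.
Qed.

Lemma cutoff_ge0 N x : 0 <= G N x.
Proof. by rewrite /G; case: ifP => // _; exact: trunc_ge0. Qed.

Lemma cutoff_le N x : G N x <= N%:R.
Proof. by rewrite /G; case: ifP => // _; rewrite /truncated_sqrt ge_min lexx orbT. Qed.

Lemma cutoff_sqr_le N x : G N x ^+ 2 <= g x.
Proof.
have /andP[g0 g1] := hgN N x; rewrite /G; case: ifP => _.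
  by rewrite expr0n/= (le_trans g0).
exact: le_trans (trunc_sqr_le N x) g1.
Qed.

Lemma cutoff_K N x : x \in K -> G N x = 0.
Proof. by rewrite /G => ->. Qed.

(** Applying [cutoff_bound] with [P = g], which dominates every squared truncation, gives a [c]
    independent of [N]; away from [K] the gradient hypothesis survives truncation. *)
Lemma grad_cutoff_le : exists c : X -> R, [/\ forall x, 0 <= c x, finite_set (supp c) &
  forall N s x, (N0 <= N)%N -> uniq s ->
    grad_on b s (G N) x <= gamma * wN N x * G N x ^+ 2 * m x + c x].
Proof.
have g0 x : 0 <= g x by have /andP[a c] := hgN 0 x; exact: le_trans c.
have [c [c0 fc Hc]] := cutoff_bound hb hlf fK g0.
have /andP[gam0 _] := hgamma.
exists c; split=> // N s x N0N us.
have tg y : trunc N y ^+ 2 <= g y.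
  by have /andP[_] := hgN N y; apply: le_trans; exact: trunc_sqr_le.
have [[xK e]|H] := Hc (trunc N) s x us tg (trunc_ge0 N); last first.
  apply: (le_trans H); rewrite lerDr; apply: mulr_ge0; last exact: ltW.
  by apply: mulr_ge0; [apply: mulr_ge0; [exact: ltW|]|exact: sqr_ge0].
rewrite e; apply: (@le_trans _ _ (gamma * wN N x * m x * trunc N x ^+ 2)); last first.
  by rewrite /G (negbTE xK) [leLHS]mulrAC lerDl.
apply: (grad_on_min hb) => [y||]; [exact: sqrtr_ge0|exact: ler0n|].
apply: le_trans (grad_on_le_gradsq hm us (hgrad N0N x)) _.
have /andP[gN0 _] := hgN N x.
by rewrite sqr_sqrtr// le_eqVlt; apply/orP; left; apply/eqP; ring.
Qed.

(** This frees both sides from [s], which varies with the approximation: the left side passes to any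
    [t] off [K], the right side to the fixed support of [a]. *)
Lemma weighted_sum_restrict (theta A e : R) (a v : X -> R) N s t k :
  0 <= theta -> (forall x, 0 <= a x) -> uniq k -> (forall x, x \in k <-> supp a x) ->
  uniq s -> (forall x, x \notin s -> v x = 0) ->
  uniq t -> (forall x, x \in t -> x \notin K) ->
  theta * \sum_(x <- s) wN N x * v x ^+ 2 * G N x ^+ 2 * m x <=
    \sum_(x <- s) a x * v x ^+ 2 + A + e ->
  theta * \sum_(x <- t) wN N x * v x ^+ 2 * trunc N x ^+ 2 * m x <=
    \sum_(x <- k) a x * v x ^+ 2 + A + e.
Proof.
move=> th0 a0 uk kE us vs ut tK H.
apply: (@le_trans _ _ (theta * \sum_(x <- s) wN N x * v x ^+ 2 * G N x ^+ 2 * m x)).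
  apply: ler_wpM2l => //.
  rewrite (_ : \sum_(x <- t) _ = \sum_(x <- t) wN N x * v x ^+ 2 * G N x ^+ 2 * m x).
    apply: ler_sum_subseq => // x.
      apply: mulr_ge0; last exact: ltW.
      by apply: mulr_ge0; [apply: mulr_ge0; [|exact: sqr_ge0]|exact: sqr_ge0].
    move=> _; apply: contraNT => /vs ->.
    by rewrite expr0n/= !(mulr0, mul0r).
  by apply: eq_big_seq => x /tK xK; rewrite /G (negbTE xK).
apply: (le_trans H); rewrite !lerD2r; apply: ler_sum_subseq => // x.
  by rewrite mulr_ge0 ?sqr_ge0.
by move=> _; rewrite mulf_eq0 negb_or => /andP[ax _]; apply/kE.
Qed.

(** Letting [G2] range over the whole interval from 0 to [g x] covers the squared cutoffs for all
    [N] with one [a] and one [al]. *)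
Variables (f a al : X -> R) (eta A : R).
Hypotheses (heta : 0 <= eta < 1 - gamma) (ha : forall x, 0 <= a x)
  (fa : finite_set (supp a))
  (hf : forall N x r G2, 0 <= G2 <= g x -> `|f x| * `|r| * G2 * m x <=
      eta * (wN N x * r ^+ 2 * G2 * m x) + a x * r ^+ 2 + al x)
  (hal : forall s, uniq s -> \sum_(x <- s) al x <= A).

Lemma source_bound N x r : `|f x| * `|r| * G N x ^+ 2 * m x <=
      eta * (wN N x * r ^+ 2 * G N x ^+ 2 * m x) + a x * r ^+ 2 + al x.
Proof. by apply: hf; rewrite sqr_ge0 cutoff_sqr_le. Qed.

Lemma agmon_l2_approximable u : approximable b m u ->
  (forall x, u x * Hformal b m q u x <= `|f x| * `|u x|) ->
  l2 [set: X] (fun x => g x * w x * m x) u.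
Proof.
move=> [_ [phi [cphi phi0 phim phi1 phie]]] hu.
have /andP[gam0 gam1] := hgamma; have /andP[eta0 eta1] := heta.
have [c [c0 fc Hc]] := grad_cutoff_le.
(* Half of the available room is spent on the product rule: [delta * gamma = theta], so the
   coefficient left after absorption is again [theta]. *)
pose theta := (1 - gamma - eta) / 2.
have th0 : 0 < theta by rewrite /theta; lra.
pose delta := theta / gamma.
have d0 : 0 < delta by rewrite divr_gt0.
have thE : 1 - (1 + delta) * gamma - eta = theta.
  by rewrite mulrDl mul1r /delta divfK ?gt_eqF// /theta; field.
pose a' x := (1 + delta) * c x + a x.
have a'0 x : 0 <= a' x.
  by apply: addr_ge0 => //; apply: mulr_ge0 => //; rewrite addr_ge0// ltW.
have fa' : finite_set (supp a').
  apply: sub_finite_set (finite_suppU fc fa) => x; rewrite /supp/= /a'.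
  apply: contraPP => /not_orP[] /negP/negPn/eqP -> /negP/negPn/eqP ->.
  by rewrite mulr0 addr0 eqxx.
have [k uk kE] := finite_set_uniq fa'.
apply: (@l2_of_approximate_bound _ _ K m g w u wN gN fK hm hgN hgN_cvg hw
  theta A a' k N0) => // N N0N.
exists (fun n x => u x * phi n x) => [x|e e0].
  by rewrite -[u x in X in _ --> X]mulr1; apply: cvgMl_tmp.
(* This multiplies the gradient error of the cutoff, with [L = N]; it is fixed while [n] grows, so
   the error falls below [e]. *)
pose B := (1 + delta^-1) * N%:R ^+ 2.
have B0 : 0 <= B.
  by apply: mulr_ge0; [rewrite addr_ge0// invr_ge0 ltW|exact: sqr_ge0].
have B1 : 0 < B + 1 by rewrite ltr_wpDl.
have [n0 Hn0] := cvge0_lt phie (divr_gt0 e0 B1).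
exists n0 => n t n0n ut tK.
have [fphi _] := cphi n.
have [s ns] := nbhd_seq_exists hb hlf fphi.
have phiE x : x \notin s -> phi n x = 0.
  by move=> xs; apply/eqP; apply: contraNT xs => px; have [] := ns.2 x px.
apply: (@weighted_sum_restrict _ _ _ _ _ _ s) => //.
- exact: ltW.
- exact: ns.1.
- by move=> x /phiE ->; rewrite mulr0.
have phi01 x : 0 <= phi n x <= 1.
  rewrite phi0/=; apply: (cvgr_to_ge (phi1 x)).
  by exists n => // l /= nl; exact: phim.
have := agmon_cutoff hm hb (hwN N) (cutoff_ge0 N) (cutoff_le N)
  (@cutoff_K N) (fun s x us => Hc N s x N0N us) (source_bound N) hal d0 fphi ns phi01 hu.
rewrite thE => /le_trans; apply; rewrite lerD2l.
have Hs : \sum_(x <- s) u x ^+ 2 * grad_on b s (phi n) x <= e / (B + 1).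
  rewrite -lee_fin; apply: le_trans (ltW (Hn0 n n0n)).
  apply: le_trans (esum_ge_seq _ ns.1 (fun _ _ => I)).
  rewrite -sumEFin; apply: lee_sum => x _.
  by rewrite (gradsq_nbhd m hb x ns) -!EFinM lee_fin -mulrA divfK// gt_eqF.
apply: le_trans (ler_wpM2l B0 Hs) _.
rewrite mulrA ler_pdivrMr// mulrC; apply: ler_wpM2l; [exact: ltW|lra].
Qed.

Lemma agmon_l2_domain u : classV b m q -> domh b m q u ->
  (forall x, Hformal b m q u x = f x) ->
  l2 [set: X] (fun x => g x * w x * m x) u.
Proof.
move=> hV [_ [v hv]] hu.
have /andP[gam0 gam1] := hgamma; have /andP[eta0 eta1] := heta.
have [c [c0 fc Hc]] := grad_cutoff_le.
have th0 : 0 < 1 - gamma - eta by lra.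
pose a' x := c x + a x.
have a'0 x : 0 <= a' x by exact: addr_ge0.
have fa' : finite_set (supp a').
  apply: sub_finite_set (finite_suppU fc fa) => x; rewrite /supp/= /a'.
  apply: contraPP => /not_orP[] /negP/negPn/eqP -> /negP/negPn/eqP ->.
  by rewrite addr0 eqxx.
have [k uk kE] := finite_set_uniq fa'.
apply: (@l2_of_approximate_bound _ _ K m g w u wN gN fK hm hgN hgN_cvg hw
  (1 - gamma - eta) A a' k N0) => // N N0N.
exists v => [x|e e0]; first exact: (hconv_cvg hm hv).
have [n0 H] := agmon_domain hm hb hlf fK (hwN N) (hwN0 N) (cutoff_ge0 N) (cutoff_le N)
  (@cutoff_K N) c0 fc (ltW gam0) (fun s x us => Hc N s x N0N us) hv hh hV
  (source_bound N) hal hu e0.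
exists n0 => n t n0n ut tK.
have [/(_ n)[fvn _] _ _] := hv.
have [s ns] := nbhd_seq_exists hb hlf fvn.
apply: (@weighted_sum_restrict _ _ _ _ _ _ s) => //.
- exact: ltW.
- exact: ns.1.
- by move=> x xs; apply/eqP; apply: contraNT xs => px; have [] := ns.2 x px.
exact: H.
Qed.

Lemma agmon_l2 u : admissible b m q f u ->
  l2 [set: X] (fun x => g x * w x * m x) u.
Proof.
case=> [[ap su]|[hV [h [du _ _]] [_ su]]]; last exact: agmon_l2_domain.
apply: agmon_l2_approximable => // x; rewrite -normrM.
case: su => [[_ ->]|[_ u0 su]]; first by rewrite mulrC ler_norm.
apply: le_trans (ler_wpM2l (u0 x) (su x)) _; by rewrite mulrC ler_norm.
Qed.

End AgmonL2.

Theorem theorem3p2 (R : realType) (X : countType) (b : X -> X -> R)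
    (m q : X -> R) (K : set X) (wN gN : nat -> X -> R) (gamma : R)
    (g w : X -> R)
    (hX : infinite_set [set: X])
    (hm : forall x, 0 < m x)
    (hb : is_graph b)
    (hlf : locally_finite b)
    (hh : bounded_below b m q)
    (hK : finite_set K)
    (hwN0 : forall N x, 0 <= wN N x)
    (hwN : forall N, hform_ge b m q (wN N) (~` K))
    (hgamma : 0 < gamma < 1)
    (hgN0 : forall N x, 0 <= gN N x)
    (hgN_mono : forall x (N M : nat), (N <= M)%N -> gN N x <= gN M x)
    (hgN_cvg : forall x, gN N x @[N --> \oo] --> g x)
    (hgrad : exists N0 : nat, forall N : nat, (N0 <= N)%N -> forall x,
       (gradsq b m (fun y => Num.sqrt (gN N y)) x
          <= (gamma * gN N x * wN N x)%:E)%E)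
    (hw : forall x, limn_einf (fun N => (wN N x)%:E) = (w x)%:E) :
  (forall f u : X -> R,
     Cc [set: X] f -> admissible b m q f u ->
     l2 [set: X] (fun x => g x * w x * m x) u)
  /\
  ((forall N x, w x <= wN N x) ->
   forall f u : X -> R,
     l2 [set x | 0 < w x] (fun x => g x * (w x)^-1 * m x) f ->
     supp f `<=` [set x | 0 < w x] ->
     admissible b m q f u ->
     l2 [set: X] (fun x => g x * w x * m x) u).
Proof.
have hgN N x : 0 <= gN N x <= g x.
  rewrite hgN0/=; apply: (cvgr_to_ge (hgN_cvg x)).
  by exists N => // M /= NM; exact: hgN_mono.
have g0 x : 0 <= g x by have /andP[u v] := hgN 0 x; exact: le_trans v.
have [N0 {}hgrad] := hgrad.
have /andP[gam0 gam1] := hgamma.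
split.
  move=> f u [ff _].
  (* From |f| |r| <= (f^2 + r^2) / 2 and G2 <= g. Both resulting terms live on the support of [f],
     so nothing is absorbed and [eta = 0]. *)
  pose a x := if f x == 0 then 0 else g x * m x / 2.
  pose al x := f x ^+ 2 * (g x * m x / 2).
  have gm x : 0 <= g x * m x / 2 by apply: mulr_ge0 => //; apply: mulr_ge0 => //; exact: ltW.
  have [k uk kE] := finite_set_uniq ff.
  apply: (@agmon_l2 _ _ b m q K wN gN gamma g w hm hb hlf hh hK hwN0 hwN hgamma hgN
    hgN_cvg N0 hgrad hw f a al 0 (\sum_(x <- k) al x)).
  - by rewrite lexx subr_gt0.
  - by move=> x; rewrite /a; case: ifP.
  - apply: sub_finite_set ff => x; rewrite /supp/= /a.
    by case: (eqVneq (f x) 0) => // _; rewrite eqxx.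
  - move=> N x r G2 /andP[G20 G2g]; rewrite mul0r add0r /a /al.
    case: eqVneq => [->|fx]; first by rewrite normr0 !mul0r expr0n/= mul0r addr0.
    apply: (@le_trans _ _ (`|f x| * `|r| * (g x * m x))).
      rewrite -mulrA; apply: ler_wpM2l; first exact: mulr_ge0.
      by rewrite ler_wpM2r// ltW.
    have -> : g x * m x / 2 * r ^+ 2 + f x ^+ 2 * (g x * m x / 2) =
       (`|f x| ^+ 2 + `|r| ^+ 2) / 2 * (g x * m x).
      by rewrite !real_normK ?num_real//; field.
    apply: ler_wpM2r; first by rewrite mulr_ge0// ltW.
    by have := sqr_ge0 (`|f x| - `|r|); nra.
  - move=> s us; apply: ler_sum_subseq => // x.
      by apply: mulr_ge0 => //; exact: sqr_ge0.
    by move=> _; rewrite mulf_eq0 expf_eq0/= negb_or => /andP[fx _]; apply/kE.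
move=> wwN f u fl2 fw.
pose eta := (1 - gamma) / 2.
have eta0 : 0 < eta by rewrite /eta; lra.
(* From |f| |r| <= eta w r^2 + f^2 / (4 eta w), followed by w <= w_N in the first term and G2 <= g
   in the second. Where [w x] is not positive [f] vanishes, and the default 0 is correct. *)
pose al x := if 0 < w x then (4 * eta)^-1 * (f x ^+ 2 * (g x * (w x)^-1 * m x)) else 0.
pose S := \esum_(x in [set x | 0 < w x]) (f x ^+ 2 * (g x * (w x)^-1 * m x))%:E.
have Sge s : uniq s -> (forall x, x \in s -> 0 < w x) ->
    \sum_(x <- s) f x ^+ 2 * (g x * (w x)^-1 * m x) <= fine S.
  move=> us sw; have := @esum_ge_seq R X [set x | 0 < w x]
    (fun x => (f x ^+ 2 * (g x * (w x)^-1 * m x))%:E) s us sw.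
  rewrite sumEFin -/S => H; rewrite -lee_fin fineK//.
  rewrite ge0_fin_numE//; apply: esum_ge0 => x wx; rewrite lee_fin.
  apply: mulr_ge0; first exact: sqr_ge0.
  by apply: mulr_ge0; [apply: mulr_ge0 => //; rewrite invr_ge0 ltW|exact: ltW].
apply: (@agmon_l2 _ _ b m q K wN gN gamma g w hm hb hlf hh hK hwN0 hwN hgamma hgN
    hgN_cvg N0 hgrad hw f (fun=> 0) al eta ((4 * eta)^-1 * fine S)).
- by rewrite ltW//= /eta; lra.
- by [].
- by rewrite /supp (_ : [set x | _] = set0)//; apply/seteqP; split=> x //=; rewrite eqxx.
- move=> N x r G2 /andP[G20 G2g]; rewrite mul0r addr0 /al.
  have rhs0 : 0 <= eta * (wN N x * r ^+ 2 * G2 * m x).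
    apply: mulr_ge0; first exact: ltW.
    apply: mulr_ge0; last exact: ltW.
    by apply: mulr_ge0 => //; apply: mulr_ge0 => //; exact: sqr_ge0.
  have [fx|fx] := eqVneq (f x) 0.
    by rewrite fx normr0 !mul0r expr0n/= mul0r mulr0 if_same addr0.
  have wx : 0 < w x by exact: fw.
  rewrite wx.
  apply: (@le_trans _ _ (eta * (w x * r ^+ 2 * G2 * m x) +
     (4 * eta)^-1 * (f x ^+ 2 * (G2 * (w x)^-1 * m x)))).
    rewrite -subr_ge0; set e := (X in 0 <= X).
    have -> : e = (2 * eta * w x * `|r| - `|f x|) ^+ 2 / (4 * eta * w x) * (G2 * m x).
      rewrite /e -(real_normK (num_real r)) -(real_normK (num_real (f x))).
      by field; rewrite !gt_eqF.
    apply: mulr_ge0; last by rewrite mulr_ge0// ltW.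
    apply: mulr_ge0; first exact: sqr_ge0.
    by rewrite invr_ge0 ltW//; apply: mulr_gt0 => //; exact: mulr_gt0.
  apply: lerD.
    apply: ler_wpM2l; first exact: ltW.
    apply: ler_wpM2r; first exact: ltW.
    by apply: ler_wpM2r => //; apply: ler_wpM2r => //; exact: sqr_ge0.
  apply: ler_wpM2l; first by rewrite invr_ge0 mulr_ge0// ltW.
  apply: ler_wpM2l; first exact: sqr_ge0.
  apply: ler_wpM2r; first exact: ltW.
  by apply: ler_wpM2r => //; rewrite invr_ge0 ltW.
- move=> s us; rewrite -big_mkcond/= -mulr_sumr -big_filter.
  apply: ler_wpM2l; first by rewrite invr_ge0 mulr_ge0// ltW.
  by apply: Sge; [exact: filter_uniq|move=> x; rewrite mem_filter => /andP[]].
Qed.
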